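(* Let $\tilde\rho:M\to S^3$ be a minimal immersion of a torus such that $\tilde\rho(M)$ is invariant under a (nontrivial) one-parameter group of isometries $\{e^{tB}:t\in\mathbb{R}\}$, $0\ne B\in so(4)$, of $S^3$. Then $nnt(M)=kn(M)$, and therefore $nnt(M)\le 5$.
   Context: $M$ is an oriented compact surface without boundary diffeomorphic to a torus, $\tilde\rho:M\to S^3\subset\mathbb{R}^4$ is a minimal immersion, and $M$ has the induced metric. $N:M\to S^3$ is a Gauss map: $N(m)\perp d\tilde\rho_m(T_mM)$ and $\langle N(m),\tilde\rho(m)\rangle=0$. $a:M\to\mathbb{R}$ is the nonnegative principal curvature function; for a torus $a$ is everywhere positive (Lawson) and smooth, and $W_1,W_2$ are fixed smooth unit tangent vector fields on $M$ with $dN(W_1)=-aW_1$, $dN(W_2)=aW_2$. $so(4)$ is the space of real skew-symmetric $4\times4$ matrices. For $B\in so(4)$, $f_B(m)=\langle B\tilde\rho(m),N(m)\rangle$. For $\theta\in\mathbb{R}$, $h_\theta=\cos(\theta)a^{-3/2}W_1(a)+\sin(\theta)a^{-3/2}W_2(a)$. The Killing nullity is $kn(M)=\dim\{f_B:B\in so(4)\}$. The natural nullity is $nnt(M)=\dim NS$, where $NS=\{f_B+\lambda h_\theta: B\in so(4),\ \lambda,\theta\in\mathbb{R}\}$, a linear subspace of $C^\infty(M)$. *)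

(* Defs.v *)
From HB Require Import structures.
From mathcomp Require Import all_boot all_order all_algebra.
From mathcomp Require Import all_classical all_reals all_analysis.

Set Implicit Arguments.
Unset Strict Implicit.
Unset Printing Implicit Defensive.

Import Order.TTheory GRing.Theory Num.Theory.
Import numFieldNormedType.Exports.

Local Open Scope classical_set_scope.
Local Open Scope ring_scope.

(* A smooth surface diffeomorphic to the torus: a set together with a bijection
   R^2/Z^2 -> M, presented by the induced map [param : R^2 -> M].  The smooth
   structure of M is the one for which this bijection is a diffeomorphism; every
   surface diffeomorphic to a torus arises in this way. *)
Record torus (R : realType) := Torus {
  carrier :> Type;
  param : 'cV[R]_2 -> carrier;
  param_surj : forall m, exists u, param u = m;
  param_eq : forall u v, param u = param v <->
    (forall i, v i 0 - u i 0 \is a Num.int) }.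

Section Smooth.
Variable R : realType.

Fixpoint Ck (k : nat) (V W : normedModType R) (f : V -> W) : Prop :=
  match k with
  | 0 => continuous f
  | k'.+1 => (forall x, differentiable f x) /\
             (forall v, Ck k' (fun x => 'd f x v))
  end.

Variables (M : torus R) (W : normedModType R).

Definition smooth (f : M -> W) : Prop :=
  forall k, Ck k (fun u : 'cV[R]_2 => f (param M u)).

Definition lift (m : M) : 'cV[R]_2 := projT1 (cid (param_surj m)).

(* The differential df_m : T_m M -> W.  Each T_m M is identified with R^2 by the
   differential of [param]; as [f \o param] is Z^2-periodic, the choice of the
   lift of m is immaterial.  A vector field on M is thus a map M -> 'cV_2. *)
Definition tdiff (f : M -> W) (m : M) (v : 'cV[R]_2) : W :=
  'd (fun u : 'cV[R]_2 => f (param M u)) (lift m) v.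

End Smooth.

Section LinearAlgebra.
Variable R : realType.

Definition dotp n (x y : 'cV[R]_n) : R := (x^T *m y) 0 0.

Definition so n : set 'M[R]_n := [set B | B^T = - B].

Definition expm n (A : 'M[R]_n.+1) : 'M[R]_n.+1 :=
  limn (series (fun k : nat => (k`!%:R)^-1 *: A ^+ k)).

Definition lin_indep (T : Type) n (F : 'I_n -> T -> R) : Prop :=
  forall c : 'I_n -> R,
    (forall x, \sum_(i < n) c i * F i x = 0) -> forall i, c i = 0.

(* Dimension of a linear subspace of the functions T -> R, as an extended real:
   the largest size of a linearly independent family of its elements
   (+oo if there is no largest one). *)
Definition fdim (T : Type) (S : set (T -> R)) : \bar R :=
  ereal_sup [set (n%:R)%:E | n in
    [set n : nat | exists F : 'I_n -> T -> R,
       (forall i, S (F i)) /\ lin_indep F]].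

End LinearAlgebra.

Section Surfaces.
Variables (R : realType) (M : torus R).
Implicit Types (rho N : M -> 'cV[R]_4) (a : M -> R) (W : M -> 'cV[R]_2).

Definition on_sphere rho : Prop := forall m, dotp (rho m) (rho m) = 1.

Definition immersion rho : Prop :=
  [/\ smooth rho, on_sphere rho
    & forall m v, tdiff rho m v = 0 -> v = 0].

Definition gauss_map rho N : Prop :=
  [/\ smooth N, on_sphere N,
      forall m, dotp (N m) (rho m) = 0
    & forall m v, dotp (N m) (tdiff rho m v) = 0].

Definition first_form rho (m : M) : 'M[R]_2 :=
  \matrix_(i, j) dotp (tdiff rho m (delta_mx i 0)) (tdiff rho m (delta_mx j 0)).

Definition second_form rho N (m : M) : 'M[R]_2 :=
  \matrix_(i, j) - dotp (tdiff N m (delta_mx i 0)) (tdiff rho m (delta_mx j 0)).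

Definition mean_curvature rho N (m : M) : R :=
  \tr (invmx (first_form rho m) *m second_form rho N m) / 2.

Definition minimal rho N : Prop := forall m, mean_curvature rho N m = 0.

Definition principal_curvature rho N (m : M) (k : R) : Prop :=
  exists2 v, v != 0 & tdiff N m v = - k *: tdiff rho m v.

Definition unit_field rho W : Prop :=
  smooth W /\ forall m, dotp (tdiff rho m (W m)) (tdiff rho m (W m)) = 1.

Definition invariant_under (X : set 'cV[R]_4) (B : 'M[R]_4) : Prop :=
  forall t x, X x -> X (expm (t *: B) *m x).

Definition f_ rho N (B : 'M[R]_4) (m : M) : R := dotp (B *m rho m) (N m).

Definition h_ a W1 W2 (theta : R) (m : M) : R :=
  cos theta * (a m `^ (- (3 / 2))) * tdiff a m (W1 m) +
  sin theta * (a m `^ (- (3 / 2))) * tdiff a m (W2 m).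

Definition KS rho N : set (M -> R) := [set f_ rho N B | B in so (n := 4)].

Definition NS rho N a W1 W2 : set (M -> R) :=
  [set f | exists B lambda theta, so B /\
     f = (fun m => f_ rho N B m + lambda * h_ a W1 W2 theta m)].

Definition killing_nullity rho N : \bar R := fdim (KS rho N).

Definition natural_nullity rho N a W1 W2 : \bar R := fdim (NS rho N a W1 W2).

End Surfaces.

(* Main.v *)
Require Import Defs.
From mathcomp Require Import all_boot all_order all_algebra.
From mathcomp Require Import all_classical all_reals all_analysis.
From mathcomp Require Import ring lra.
Import Order.TTheory GRing.Theory Num.Theory.
Import numFieldNormedType.Exports.
Set Implicit Arguments.
Unset Strict Implicit.
Unset Printing Implicit Defensive.
Local Open Scope classical_set_scope.
Local Open Scope ring_scope.

(** Write [T] for the Killing field [B rho].  Two facts carry the proof: [T] is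
    tangent to the surface, and the Hopf differential [Q] is constant along it.

    Tangency ([invariant_tangent]).  The image of the surface is invariant, but
    the surface may cross itself, so an orbit could conceivably leave one sheet
    for another.  If [T] had a normal component at [u0], then
    [(t, u) |-> expm (t B) rho u] would expand distances near [(0, u0)], up to a
    factor, and send the [n ^ 3] points of a grid to points at mutual distance at
    least of order [1 / n].  But these are values of the Lipschitz map [rho] on the
    unit square, which leaves room for order [n ^ 2] such points only
    ([invariant_not_transverse]).  Thus [f_B = 0].

    Hopf differential.  Let [e1], [e2] be a principal orthonormal frame, and
    [p], [q] the components of [T].  Differentiating [f_B = 0] gives
    [B N = - a p e1 + a q e2], the image of [T] under [dN].  Then [<B rho, B N>]
    and [|B rho|^2 |B N|^2], which are the real part (up to sign) and the squared
    modulus of [Q (T, T)], have zero derivative in both principal directions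
    ([hopf_real_cst], [hopf_norm_cst]), so [a |T|^2] is a constant [c].

    If [c = 0], then [a] vanishes identically, since a nonzero skew-symmetric
    matrix cannot kill a piece of surface of the sphere ([totally_geodesic]); all
    the functions [h_theta] are then zero.  If [c > 0], then [a] and [T] have no
    zero, [sqrt a p] and [sqrt a q] are constant ([killing_components_cst]), and
    differentiating [a |T|^2 = c] gives
      [a^(-3/2) W1(a) = (2 / c) beta sqrt a q],
      [a^(-3/2) W2(a) = - (2 / c) beta sqrt a p]
    with [beta = <B e2, e1>] ([curvature_diff]).  The Hodge star exchanges the
    normal plane [(rho, N)] and the tangent plane [(e1, e2)], so [beta] is, up to
    the constant orientation of the frame, the function [f_(star B)]
    ([rotation_star]).  In both cases every [h_theta] is some [f_C], hence the two
    spaces of functions coincide.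

    Finally [so 4] has dimension 6 and [B] is a nonzero element of the kernel of
    [C |-> f_C], whose range has thus dimension at most 5
    ([killing_nullity_le5]). *)

(** * Inner product and differentials *)

Section Calculus.
Context {R : realType}.

Lemma dotpE n (x y : 'cV[R]_n) : dotp x y = \sum_i x i 0 * y i 0.
Proof. by rewrite /dotp mxE; apply: eq_bigr => i _; rewrite mxE. Qed.

Lemma dotpC n (x y : 'cV[R]_n) : dotp x y = dotp y x.
Proof. by rewrite !dotpE; apply: eq_bigr => i _; rewrite mulrC. Qed.

Lemma dotpDl n (x y z : 'cV[R]_n) : dotp (x + y) z = dotp x z + dotp y z.
Proof. by rewrite /dotp linearD mulmxDl mxE. Qed.

Lemma dotpZl n k (x z : 'cV[R]_n) : dotp (k *: x) z = k * dotp x z.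
Proof. by rewrite /dotp linearZ -scalemxAl mxE. Qed.

Lemma dotpDr n (x y z : 'cV[R]_n) : dotp z (x + y) = dotp z x + dotp z y.
Proof. by rewrite !(dotpC z) dotpDl. Qed.

Lemma dotpZr n k (x z : 'cV[R]_n) : dotp z (k *: x) = k * dotp z x.
Proof. by rewrite !(dotpC z) dotpZl. Qed.

Lemma dotp0l n (z : 'cV[R]_n) : dotp 0 z = 0.
Proof. by rewrite /dotp trmx0 mul0mx mxE. Qed.

Lemma dotp_ge0 n (x : 'cV[R]_n) : 0 <= dotp x x.
Proof. by rewrite dotpE; apply: sumr_ge0 => i _; rewrite -expr2 sqr_ge0. Qed.

Lemma dotp_eq0 n (x : 'cV[R]_n) : dotp x x = 0 -> x = 0.
Proof.
rewrite dotpE => /eqP; rewrite psumr_eq0; last first.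
  by move=> i _; rewrite -expr2 sqr_ge0.
move=> /allP h; apply/matrixP => i j; rewrite (ord1 j) mxE.
by have := h i (mem_index_enum _); rewrite /= mulf_eq0 orbb => /eqP.
Qed.

Lemma dotp_so n (B : 'M[R]_n) (x y : 'cV[R]_n) :
  so B -> dotp (B *m x) y = - dotp x (B *m y).
Proof.
rewrite /so /= => hB; rewrite /dotp trmx_mul hB mulmxN mulNmx mxE mulmxA.
by congr (- _).
Qed.

Lemma dotp_so_diag n (B : 'M[R]_n) (x : 'cV[R]_n) :
  so B -> dotp (B *m x) x = 0.
Proof. by move=> hB; have := dotp_so x x hB; rewrite (dotpC x); lra. Qed.

Section Differentials.
Context {V : normedModType R}.

Lemma diff_coord m n (f : V -> 'M[R]_(m, n)) i j x v : differentiable f x ->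
  differentiable (fun y => f y i j) x /\
  'd (fun y => f y i j) x v = ('d f x v) i j.
Proof.
move=> df.
have dc : differentiable (fun y => f y i j) x.
  exact: (differentiable_comp df (differentiable_coord (f x) i j)).
split=> //; rewrite -!deriveE// derive_mx ?mxE//; exact: diff_derivable.
Qed.

Lemma diff_dotp n (f g : V -> 'cV[R]_n) x v :
  differentiable f x -> differentiable g x ->
  differentiable (fun y => dotp (f y) (g y)) x /\
  'd (fun y => dotp (f y) (g y)) x v =
    dotp ('d f x v) (g x) + dotp (f x) ('d g x v).
Proof.
move=> df dg.
have -> : (fun y => dotp (f y) (g y)) =
    \sum_(i < n) (fun y => f y i 0) * (fun y => g y i 0).
  by apply/funext => y; rewrite dotpE fct_sumE.
have cf i := diff_coord i 0 v df.
have cg i := diff_coord i 0 v dg.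
split.
  by apply: differentiable_sum => i; apply: differentiableM;
    [have [] := cf i|have [] := cg i].
rewrite -deriveE; last first.
  by apply: differentiable_sum => i; apply: differentiableM;
    [have [] := cf i|have [] := cg i].
rewrite derive_sum; last first.
  by move=> i; apply: derivableM; apply: diff_derivable;
    [have [] := cf i|have [] := cg i].
rewrite !dotpE -big_split; apply: eq_bigr => i _ /=.
have [dfi efi] := cf i; have [dgi egi] := cg i.
rewrite deriveM; [|exact: diff_derivable..].
have -> : 'D_v (fun y => f y i 0) x = 'd f x v i 0 by rewrite -efi deriveE.
have -> : 'D_v (fun y => g y i 0) x = 'd g x v i 0 by rewrite -egi deriveE.
by rewrite /GRing.scale /= addrC; congr (_ + _); exact: mulrC.
Qed.

Lemma mx_continuous (T : topologicalType) m n (f : T -> 'M[R]_(m, n)) :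
  (forall i j, continuous (fun x => f x i j)) -> continuous f.
Proof.
move=> cf x; apply/cvgrPdist_le => e e0; near=> y.
rewrite /Num.norm /= mx_normrE; apply: bigmax_le; first exact: ltW.
move=> i _ /=; rewrite !mxE; move: i; near: y.
apply: filter_forall => i.
by have /cvgrPdist_le := cf i.1 i.2 x; apply.
Unshelve. all: by end_near. Qed.

Lemma coord_continuousT (T : topologicalType) m n (f : T -> 'M[R]_(m, n)) i j :
  continuous f -> continuous (fun x => f x i j).
Proof.
move=> cf x.
exact: (@continuous_comp _ _ _ f (fun M : 'M[R]_(m, n) => M i j) x (cf x)
  (@coord_continuous _ _ _ i j (f x))).
Qed.

Lemma sum_continuous (T : topologicalType) (I : Type) (r : seq I)
    (F : I -> T -> R) :
  (forall i, continuous (F i)) -> continuous (fun x => \sum_(i <- r) F i x).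
Proof.
move=> cF; elim: r => [|i r ih] x.
  under eq_fun do rewrite big_nil.
  exact: cvg_cst.
under eq_fun do rewrite big_cons.
by apply: cvgD; [exact: cF|exact: ih].
Qed.

Lemma mulmx_continuous (T : topologicalType) m n p (f : T -> 'M[R]_(m, n))
    (g : T -> 'M[R]_(n, p)) :
  continuous f -> continuous g -> continuous (fun x => f x *m g x).
Proof.
move=> cf cg; apply: mx_continuous => i j.
have -> : (fun x => (f x *m g x) i j) = (fun x => \sum_k f x i k * g x k j).
  by apply/funext => x; rewrite mxE.
apply: sum_continuous => k x.
by apply: cvgM; apply: coord_continuousT.
Qed.

Lemma dotp_continuous (T : topologicalType) n (f g : T -> 'cV[R]_n) :
  continuous f -> continuous g -> continuous (fun x => dotp (f x) (g x)).
Proof.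
move=> cf cg.
have -> : (fun x => dotp (f x) (g x)) = (fun x => \sum_k f x k 0 * g x k 0).
  by apply/funext => x; rewrite dotpE.
apply: sum_continuous => k x.
by apply: cvgM; apply: coord_continuousT.
Qed.

Lemma diff_mulmx m n (B : 'M[R]_(m, n)) (f : V -> 'cV[R]_n) x v :
  differentiable f x ->
  differentiable (fun y => B *m f y) x /\
  'd (fun y => B *m f y) x v = B *m 'd f x v.
Proof.
move=> df.
have cB : continuous (mulmx B : 'cV[R]_n -> 'cV[R]_m).
  apply: mulmx_continuous; first exact: cst_continuous.
  by move=> z; exact: cvg_id.
have dB y : differentiable (mulmx B : 'cV[R]_n -> 'cV[R]_m) y.
  exact: linear_differentiable.
split; first exact: (differentiable_comp df (dB _)).
have -> : (fun y => B *m f y) = (mulmx B : 'cV[R]_n -> 'cV[R]_m) \o f by [].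
by rewrite diff_comp//= diff_lin.
Qed.

Lemma mvt_line (f : V -> R) u w : (forall x, differentiable f x) ->
  exists2 s, 0 <= s <= 1 & f (u + w) - f u = 'd f (u + s *: w) w.
Proof.
move=> df.
pose g s := f (u + s *: w).
have dg (s : R) : is_derive s (1 : R) g ('d f (u + s *: w) w).
  have dl : is_diff s (fun s : R => u + s *: w) ( *:%R^~ w).
    by apply: is_diff_eq; rewrite add0r.
  have dgs : is_diff s g ('d f (u + s *: w) \o ( *:%R^~ w)).
    apply: is_diff_comp; exact: differentiableP.
  apply: DeriveDef; first by apply: diff_derivable.
  by rewrite deriveE ?diff_val//= scale1r.
have [|s s01 e] := @MVT_segment R g (fun s => 'd f (u + s *: w) w) 0 1 ler01
  (fun s _ => dg s).
  apply: continuous_subspaceT => s.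
  by apply: differentiable_continuous; apply/derivable1_diffP.
exists s; first by move: s01; rewrite in_itv.
by move: e; rewrite subr0 mulr1 /g scale1r scale0r addr0.
Qed.

Lemma diff0_cst (f : V -> R) : (forall x, differentiable f x) ->
  (forall x v, 'd f x v = 0) -> forall x y, f x = f y.
Proof.
move=> df d0 x y; have [s _] := mvt_line y (x - y) df.
by rewrite d0 subrKC => /eqP; rewrite subr_eq0 => /eqP.
Qed.

(** A change of sign would produce a zero, by the intermediate value theorem on
    a segment. *)
Lemma sqr_cst_cst (f : V -> R) : continuous f ->
  (forall x y, f x ^+ 2 = f y ^+ 2) -> forall x y, f x = f y.
Proof.
move=> cf f2 x y.
have /eqP := f2 x y; rewrite eqf_sqr => /orP[/eqP//|/eqP fxy].
pose g s := f (x + s *: (y - x)).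
have cg : continuous g.
  move=> s; apply: continuous_comp; last exact: cf.
  by apply: cvgD; [exact: cvg_cst|apply: cvgZr_tmp; exact: cvg_id].
have [|s _ gs] := @IVT R g 0 1 0 ler01 (continuous_subspaceT cg).
  rewrite /g scale0r scale1r addr0 subrKC fxy.
  by rewrite minElt maxElt; case: ltP => ?; apply/andP; split; lra.
have := f2 (x + s *: (y - x)) x; have := f2 (x + s *: (y - x)) y.
rewrite -/(g s) gs expr0n /= => /esym/eqP; rewrite sqrf_eq0 => /eqP ->.
by move=> /esym/eqP; rewrite sqrf_eq0 => /eqP ->.
Qed.

End Differentials.
End Calculus.

(** * Symmetry of second derivatives *)

Section DiffShift.
Context {R : realType} {V W : normedModType R}.

Lemma diff_shift (f : V -> W) c x v : differentiable f (x + c) ->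
  differentiable (fun y => f (y + c)) x /\
  'd (fun y => f (y + c)) x v = 'd f (x + c) v.
Proof.
move=> df.
have dl : is_diff x (fun y : V => y + c) id.
  by apply: is_diff_eq; rewrite addr0.
have dfc : is_diff x (f \o (fun y : V => y + c)) ('d f (x + c) \o id).
  by apply: is_diff_comp; exact: differentiableP.
by split; [exact: ex_diff|rewrite diff_val].
Qed.

End DiffShift.

Section SecondDerivative.
Context {R : realType} {V : normedModType R}.

Let second_difference (f : V -> R) u v w :=
  f (u + v + w) - f (u + v) - (f (u + w) - f u).

Lemma second_differenceE (f : V -> R) u v w h :
  (forall x, differentiable f x) ->
  (forall x, differentiable (fun y => 'd f y v) x) ->
  exists s t, [/\ 0 <= s <= 1, 0 <= t <= 1 &
    second_difference f u (h *: v) (h *: w) =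
    h ^+ 2 * 'd (fun y => 'd f y v) (u + h *: (s *: v + t *: w)) w].
Proof.
move=> df ddf.
pose g y := f (y + h *: w) - f y.
have dg x c : differentiable g x /\ 'd g x c = 'd f (x + h *: w) c - 'd f x c.
  have [dfs es] := diff_shift c (df (x + h *: w)).
  have -> : g = (fun y => f (y + h *: w)) - f by [].
  split; first exact: differentiableB.
  by rewrite diffB// -es.
have [s s01 es] := mvt_line u (h *: v) (fun x => proj1 (dg x 0)).
have [t t01 et] := mvt_line (u + s *: (h *: v)) (h *: w) ddf.
exists s, t; split=> //.
have -> : second_difference f u (h *: v) (h *: w) = g (u + h *: v) - g u by [].
rewrite es (dg _ (h *: v)).2.
have lin x c : 'd f x (h *: c) = h * 'd f x c by rewrite linearZ.
rewrite !lin -mulrBr et.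
have -> : u + h *: (s *: v + t *: w) = u + s *: (h *: v) + t *: (h *: w).
  by rewrite scalerDr !scalerA addrA (mulrC h s) (mulrC h t).
by rewrite linearZ expr2 -mulrA.
Qed.

(** Both sides are limits of one and the same second difference divided by
    [h ^ 2], by the mean value theorem applied twice, in either order. *)
Lemma schwarz (f : V -> R) u v w :
  (forall x, differentiable f x) ->
  (forall c x, differentiable (fun y => 'd f y c) x) ->
  (forall c d, continuous (fun x => 'd (fun y => 'd f y c) x d)) ->
  'd (fun y => 'd f y v) u w = 'd (fun y => 'd f y w) u v.
Proof.
move=> df ddf cddf.
pose A x := 'd (fun y => 'd f y v) x w.
pose B x := 'd (fun y => 'd f y w) x v.
rewrite -/(A u) -/(B u); apply/eqP; rewrite -subr_eq0 -normr_le0.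
apply/ler_addgt0Pl => e e0; rewrite addr0.
have e2 : 0 < e / 2 by rewrite divr_gt0.
have : \forall x \near u, `|A u - A x| <= e / 2 /\ `|B u - B x| <= e / 2.
  near=> x; split; near: x.
    by have /cvgrPdist_le := cddf v w u; apply.
  by have /cvgrPdist_le := cddf w v u; apply.
move=> /nbhs_normP[r /= r0 hr].
pose K := `|v| + `|w| + 1.
have K0 : 0 < K by rewrite ltr_wpDl// addr_ge0.
pose h := r / (2 * K).
have h0 : 0 < h by rewrite divr_gt0// mulr_gt0.
have near_u s t a b : 0 <= s <= 1 -> 0 <= t <= 1 -> `|a| + `|b| < K ->
    ball_ (fun x => `|x|) u r (u + h *: (s *: a + t *: b)).
  move=> /andP[s0 s1] /andP[t0 t1] abK.
  rewrite /ball_ /= opprD addNKr normrN normrZ (gtr0_norm h0).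
  have : `|s *: a + t *: b| <= K.
    apply: le_trans (ler_normD _ _) _; rewrite !normrZ (ger0_norm s0) (ger0_norm t0).
    have := normr_ge0 a; have := normr_ge0 b; nra.
  move=> hK; apply: (@le_lt_trans _ _ (h * K)); first by rewrite ler_wpM2l// ltW.
  rewrite /h invfM -!mulrA (mulrC _ K) !mulrA mulfK ?gt_eqF//.
  by rewrite ltr_pdivrMr// mulr_natr mulr2n ltrDl.
have [s [t [s01 t01 eA]]] := second_differenceE u w h df (ddf v).
have [s' [t' [s'01 t'01 eB]]] := second_differenceE u v h df (ddf w).
have sym : second_difference f u (h *: v) (h *: w) =
           second_difference f u (h *: w) (h *: v).
  by rewrite /second_difference (addrAC u); ring.
have h2 : h ^+ 2 != 0 by rewrite sqrf_eq0 gt_eqF.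
move: eA; rewrite sym eB => /(mulfI h2).
rewrite -[LHS]/(B _) -[RHS]/(A _).
have vwK : `|v| + `|w| < K by rewrite /K ltrDl.
have wvK : `|w| + `|v| < K by rewrite addrC.
have [hA _] := hr _ (near_u s t v w s01 t01 vwK).
have [_ hB] := hr _ (near_u s' t' w v s'01 t'01 wvK).
move=> eBA; rewrite eBA in hB.
rewrite (splitr e) -(subrKA (A (u + h *: (s *: v + t *: w)))).
apply: le_trans (ler_normD _ _) _; apply: lerD => //.
by rewrite distrC.
Unshelve. all: by end_near. Qed.

End SecondDerivative.

Section Plane.
Context {R : realType}.

Lemma diff_plane (W : normedModType R) (f : 'cV[R]_2 -> W) x v :
  'd f x v = v 0 0 *: 'd f x (delta_mx 0 0) + v 1 0 *: 'd f x (delta_mx 1 0).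
Proof.
rewrite {1}(matrix_sum_delta v) !big_ord_recl !big_ord0 !addr0.
have -> : lift 0 0 = 1 :> 'I_2 by apply/val_inj.
by rewrite linearD !linearZ.
Qed.

Lemma continuous_diff m n (f : 'cV[R]_2 -> 'M[R]_(m, n)) (w : 'cV[R]_2 -> 'cV[R]_2) :
  Ck 1 f -> continuous w -> continuous (fun x => 'd f x (w x)).
Proof.
move=> [_ cf] cw.
have -> : (fun x => 'd f x (w x)) =
  (fun x => w x 0 0 *: 'd f x (delta_mx 0 0) + w x 1 0 *: 'd f x (delta_mx 1 0)).
  by apply/funext => x; rewrite diff_plane.
have term i : continuous (fun x => w x i 0 *: 'd f x (delta_mx i 0)).
  move=> x; have c1 := @coord_continuousT R _ _ _ w i 0 cw x.
  exact: (cvgZ c1 (cf (delta_mx i 0) x)).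
by move=> x; exact: (cvgD (term 0 x) (term 1 x)).
Qed.

Lemma schwarz_mx m n (f : 'cV[R]_2 -> 'M[R]_(m, n)) u v w : Ck 2 f ->
  'd (fun y => 'd f y v) u w = 'd (fun y => 'd f y w) u v.
Proof.
move=> [df /= ddf]; apply/matrixP => i j.
have e1 c : (fun y => 'd f y c i j) = (fun y => 'd (fun z => f z i j) y c).
  by apply/funext => y; rewrite (diff_coord i j c (df y)).2.
have e2 x c d : 'd (fun y => 'd f y c) x d i j =
    'd (fun y => 'd (fun z => f z i j) y c) x d.
  by rewrite -(diff_coord i j d ((ddf c).1 x)).2 e1.
rewrite !e2; apply: schwarz.
- by move=> x; have [] := diff_coord i j 0 (df x).
- by move=> c x; rewrite -e1; have [] := diff_coord i j 0 ((ddf c).1 x).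
- move=> c d.
  have -> : (fun x => 'd (fun y => 'd (fun z => f z i j) y c) x d) =
    (fun x => 'd (fun y => 'd f y c) x d i j) by apply/funext => x; rewrite e2.
  by apply: coord_continuousT; exact: (ddf c).2.
Qed.

End Plane.

(** * The matrix exponential near zero *)

Section MatrixNorm.
Context {R : realType}.

Lemma le_mx_norm m n (A : 'M[R]_(m, n)) i j : `|A i j| <= `|A|.
Proof.
rewrite [leRHS]/Num.norm /= mx_normrE.
exact: (le_bigmax _ (fun ij => `|A ij.1 ij.2|) (i, j)).
Qed.

Lemma mx_norm_le m n (A : 'M[R]_(m, n)) c :
  0 <= c -> (forall i j, `|A i j| <= c) -> `|A| <= c.
Proof.
move=> c0 hA; rewrite /Num.norm /= mx_normrE.
by apply: bigmax_le => // ij _; exact: hA.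
Qed.

Lemma mx_normM m n p (A : 'M[R]_(m, n)) (B : 'M[R]_(n, p)) :
  `|A *m B| <= n%:R * `|A| * `|B|.
Proof.
apply: mx_norm_le => [|i j]; first by rewrite !mulr_ge0.
rewrite mxE; apply: le_trans (ler_norm_sum _ _ _) _.
apply: (@le_trans _ _ (\sum_(k < n) `|A| * `|B|)).
  by apply: ler_sum => k _; rewrite normrM ler_pM// le_mx_norm.
by rewrite sumr_const card_ord -mulrA mulr_natl.
Qed.

Lemma mx_normX n (A : 'M[R]_n.+1) k : `|A ^+ k| <= (n.+1%:R * `|A|) ^+ k.
Proof.
elim: k => [|k ih].
  rewrite !expr0; apply: mx_norm_le => // i j; rewrite mxE.
  by case: (i == j); rewrite ?normr1 ?normr0.
rewrite !exprS; apply: le_trans (mx_normM _ _) _.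
by rewrite ler_wpM2l// mulr_ge0.
Qed.

End MatrixNorm.

Section MatrixExponential.
Context {R : realType} {n : nat}.
Implicit Types (A : 'M[R]_n.+1) (t s r : R).

Let expm_coeff A k : 'M[R]_n.+1 := (k`!%:R)^-1 *: A ^+ k.

Lemma is_cvg_expm A : cvgn (series (expm_coeff A)).
Proof.
suff : cvgn [normed series (expm_coeff A)].
  move=> /cauchy_cvgP/cauchy_seriesP ncvg.
  apply/cauchy_cvgP/cauchy_seriesP => e /ncvg.
  apply: filterS => k /=; rewrite ger0_norm ?sumr_ge0//.
  by apply: le_lt_trans; apply: ler_norm_sum.
apply: (@series_le_cvg _ _ (exp_coeff (n.+1%:R * `|A|))).
- by move=> k /=.
- by move=> k; rewrite /exp_coeff /= divr_ge0// exprn_ge0// mulr_ge0.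
- move=> k; rewrite /= /expm_coeff normrZ ger0_norm ?invr_ge0//.
  by rewrite mulrC ler_wpM2r ?invr_ge0// mx_normX.
- exact: is_cvg_series_exp_coeff.
Qed.

Lemma expm0 : expm 0 = 1 :> 'M[R]_n.+1.
Proof.
apply: cvg_lim => //; apply/cvgrPdist_lt => e e0; near=> k.
have [j ->] : exists j, k = j.+1.
  by exists k.-1; rewrite prednK //; near: k; exists 1%N.
rewrite /series /= big_nat_recl// big1 ?addr0 => [|i _]; last first.
  by rewrite exprS mul0r scaler0.
by rewrite expr0 fact0 invr1 scale1r subrr normr0.
Unshelve. all: by end_near. Qed.

Lemma dist_expr_le t s r k : 0 <= r <= 1 -> `|t| <= r -> `|s| <= r ->
  `|t ^+ k.+2 - s ^+ k.+2| <= k.+2%:R * r * `|t - s|.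
Proof.
move=> /andP[r0 r1] tr sr.
have hX x j : `|x| <= r -> `|x ^+ j| <= 1.
  by move=> xr; rewrite normrX exprn_ile1// (le_trans xr).
elim: k => [|k ih].
  rewrite subr_sqr normrM mulrC ler_wpM2r// mulr_natl mulr2n.
  by apply: le_trans (ler_normD _ _) _; exact: lerD.
have -> : t ^+ k.+3 - s ^+ k.+3 =
    t * (t ^+ k.+2 - s ^+ k.+2) + (t - s) * s * s ^+ k.+1.
  by rewrite !exprS; ring.
apply: le_trans (ler_normD _ _) _; rewrite !normrM.
have -> : k.+3%:R * r * `|t - s| = k.+2%:R * r * `|t - s| + r * `|t - s|.
  by rewrite -[k.+3]addn1 natrD; ring.
apply: lerD; first by apply: le_trans ih; rewrite ler_piMl// (le_trans tr).
rewrite -mulrA mulrC ler_wpM2r//.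
have := hX s k.+1 sr; have := normr_ge0 (s ^+ k.+1); have := normr_ge0 s; nra.
Qed.

(** Strict differentiability at [0] of the one-parameter group: beyond the linear
    term each term of the series is Lipschitz, with a constant proportional to the
    radius, and these constants are summable. *)
Lemma expm_lipschitz A : exists2 C, 0 <= C & forall t s r, 0 <= r <= 1 ->
  `|t| <= r -> `|s| <= r ->
  `|expm (t *: A) - expm (s *: A) - (t - s) *: A| <= C * r * `|t - s|.
Proof.
set b := n.+1%:R * `|A|.
have b0 : 0 <= b by rewrite mulr_ge0.
exists (b * expR b) => [|t s r r01 tr sr]; first by rewrite mulr_ge0// expR_ge0.
have [r0 r1] := andP r01.
pose D k := expm_coeff (t *: A) k - expm_coeff (s *: A) k.
have DE k : D k = (k`!%:R^-1 * (t ^+ k - s ^+ k)) *: A ^+ k.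
  by rewrite /D /expm_coeff !exprZn !scalerA -scalerBl mulrBr.
have cD : series D @ \oo --> expm (t *: A) - expm (s *: A).
  have -> : series D = series (expm_coeff (t *: A)) - series (expm_coeff (s *: A)).
    apply/funext => k; rewrite /series /=.
    by rewrite -[RHS]/(_ - _) /= -sumrB.
  by apply: cvgB; exact: is_cvg_expm.
have cN : (fun k => `|series D k - (t - s) *: A|) @ \oo -->
    `|expm (t *: A) - expm (s *: A) - (t - s) *: A|.
  by apply: cvg_norm; apply: cvgB => //; exact: cvg_cst.
rewrite -(cvg_lim _ cN)//; apply: limr_le; first by apply/cvg_ex; eexists; exact: cN.
near=> k.
have [j ->] : exists j, k = j.+2.
  by exists k.-2; rewrite -subn2 -addn2 subnK//; near: k; exists 2%N.
have D0 : D 0 = 0 by rewrite DE !expr0 subrr mulr0 scale0r.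
have D1 : D 1 = (t - s) *: A by rewrite DE !expr1 invr1 mul1r.
rewrite /series /= !big_nat_recl// D0 D1 add0r addrAC subrr add0r.
apply: le_trans (ler_norm_sum _ _ _) _.
apply: (@le_trans _ _ (\sum_(0 <= i < j) b * r * `|t - s| * exp_coeff b i.+1)).
  apply: ler_sum => i _; rewrite DE normrZ normrM.
  rewrite ger0_norm ?invr_ge0// /exp_coeff /=.
  have hA := mx_normX A i.+2; have hd := dist_expr_le i r01 tr sr.
  apply: (@le_trans _ _ (i.+2`!%:R^-1 * (i.+2%:R * r * `|t - s|) * b ^+ i.+2)).
    by rewrite -[leLHS]mulrA -[leRHS]mulrA ler_wpM2l ?invr_ge0// ler_pM.
  rewrite [i.+2`!]factS natrM exprS.
  have x0 : i.+2%:R != 0 :> R by rewrite pnatr_eq0.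
  have y0 : (i.+1)`!%:R != 0 :> R by rewrite pnatr_eq0 -lt0n fact_gt0.
  move: x0 y0; move: (i.+2%:R) ((i.+1)`!%:R) => x y x0 y0.
  by rewrite le_eqVlt; apply/orP; left; apply/eqP; field; rewrite x0 y0.
have h : \sum_(0 <= i < j) exp_coeff b i.+1 <= expR b.
  apply: (@le_trans _ _ (series (exp_coeff b) j.+1)).
    by rewrite /series /= [leRHS]big_nat_recl// lerDr divr_ge0.
  apply: nondecreasing_cvgn_le; last exact: is_cvg_series_exp_coeff.
  by apply: nondecreasing_series => i _ _; rewrite /exp_coeff /= divr_ge0// exprn_ge0.
have -> : b * expR b * r * `|t - s| = b * r * `|t - s| * expR b by ring.
by rewrite -mulr_sumr ler_wpM2l// !mulr_ge0.
Unshelve. all: by end_near. Qed.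

End MatrixExponential.

(** * Lipschitz estimates and a counting argument *)

Section CoordinateEstimates.
Context {R : realType} {m : nat}.
Implicit Types (f : 'cV[R]_2 -> 'cV[R]_m) (u v w : 'cV[R]_2).

Lemma mvt_coord f u v i : (forall x, differentiable f x) ->
  exists2 s, 0 <= s <= 1 &
    (f u - f v) i 0 = 'd f (v + s *: (u - v)) (u - v) i 0.
Proof.
move=> df.
have [s s01 es] := mvt_line v (u - v) (fun x => (diff_coord i 0 0 (df x)).1).
exists s => //; move: es; rewrite subrKC (diff_coord i 0 (u - v) (df _)).2 => <-.
by rewrite !mxE.
Qed.

Let plane_linear (A : 'cV[R]_2 -> 'cV[R]_m) :=
  forall w, A w = w 0 0 *: A (delta_mx 0 0) + w 1 0 *: A (delta_mx 1 0).

Let plane_dist_le (A A' : 'cV[R]_2 -> 'cV[R]_m) w c :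
  plane_linear A -> plane_linear A' ->
  (forall j, `|A (delta_mx j 0) - A' (delta_mx j 0)| <= c) ->
  `|A w - A' w| <= 2 * c * `|w|.
Proof.
move=> hA hA' hc; rewrite hA hA' opprD addrACA -!scalerBr.
apply: le_trans (ler_normD _ _) _.
have h j : `|w j 0 *: (A (delta_mx j 0) - A' (delta_mx j 0))| <= c * `|w|.
  by rewrite normrZ mulrC ler_pM// le_mx_norm.
by have := h 0; have := h 1; lra.
Qed.

Lemma diff_norm_le f x w c : (forall j, `|'d f x (delta_mx j 0)| <= c) ->
  `|'d f x w| <= 2 * c * `|w|.
Proof.
move=> hc; have := @plane_dist_le ('d f x) (fun=> 0) w c (diff_plane f x).
rewrite subr0; apply => [w'|j]; first by rewrite !scaler0 addr0.
by rewrite subr0.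
Qed.

Lemma diff_dist_le f x y w c :
  (forall j, `|'d f x (delta_mx j 0) - 'd f y (delta_mx j 0)| <= c) ->
  `|'d f x w - 'd f y w| <= 2 * c * `|w|.
Proof. exact: plane_dist_le (diff_plane f x) (diff_plane f y). Qed.

(** Strict differentiability: by the mean value theorem in each coordinate, it
    suffices that the derivative stays close to that at [u0]. *)
Lemma C1_strict f u0 e : Ck 1 f -> 0 < e ->
  exists2 d, 0 < d & forall u v, `|u - u0| <= d -> `|v - u0| <= d ->
    `|f u - f v - 'd f u0 (u - v)| <= e * `|u - v|.
Proof.
move=> [df cf] e0.
have e2 : 0 < e / 2 by rewrite divr_gt0.
have : \forall x \near u0, forall j : 'I_2,
    `|'d f u0 (delta_mx j 0) - 'd f x (delta_mx j 0)| <= e / 2.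
  near=> x => j; move: j; near: x; apply: filter_forall => j.
  by have /cvgrPdist_le := cf (delta_mx j 0) u0; apply.
move=> /nbhs_normP[d /= d0 hd].
exists (d / 2) => [|u v hu hv]; first by rewrite divr_gt0.
apply: mx_norm_le => [|i j]; first by rewrite mulr_ge0// ltW.
rewrite (ord1 j) {j}; have [s /andP[s0 s1] es] := mvt_coord u v i df.
set x := v + s *: (u - v) in es.
have hx : ball_ (fun z => `|z|) u0 d x.
  rewrite /ball_ /= distrC.
  have -> : x - u0 = (1 - s) *: (v - u0) + s *: (u - u0).
    by apply/matrixP => k l; rewrite !mxE; ring.
  apply: (@le_lt_trans _ _ (d / 2)); last first.
    by rewrite ltr_pdivrMr// mulr_natr mulr2n ltrDl.
  apply: le_trans (ler_normD _ _) _.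
  rewrite !normrZ (ger0_norm s0) ger0_norm ?subr_ge0//.
  have := normr_ge0 (u - u0); have := normr_ge0 (v - u0); nra.
rewrite mxE es [X in _ + X]mxE.
apply: (@le_trans _ _ `|'d f x (u - v) - 'd f u0 (u - v)|).
  by have := le_mx_norm ('d f x (u - v) - 'd f u0 (u - v)) i 0; rewrite !mxE.
apply: le_trans (diff_dist_le _ (c := e / 2) _) _; last by rewrite (mulrC 2) divfK.
by move=> k; rewrite distrC hd.
Unshelve. all: by end_near. Qed.

Lemma C1_lipschitz_square f : Ck 1 f -> exists2 L, 0 <= L &
  forall u v, (forall i, 0 <= u i 0 <= 1) -> (forall i, 0 <= v i 0 <= 1) ->
    `|f u - f v| <= L * `|u - v|.
Proof.
move=> [df cf].
pose pt (xy : R * R) : 'cV[R]_2 := \col_i (if i == 0 then xy.1 else xy.2).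
have cpt : continuous pt.
  apply: mx_continuous => i j.
  have -> : (fun xy => pt xy i j) = (if i == 0 then fst else snd).
    by apply/funext => xy; rewrite mxE; case: (i == 0).
  by case: (i == 0) => xy; [exact: cvg_fst|exact: cvg_snd].
have bound (j : 'I_2) : exists2 c : R, 0 <= c & forall x : 'cV[R]_2,
      (forall i, 0 <= x i 0 <= 1) ->
    `|'d f x (delta_mx j 0)| <= c.
  pose g xy := `|'d f (pt xy) (delta_mx j 0)|.
  have cg : continuous g.
    move=> xy; apply: cvg_norm.
    exact: (@continuous_comp _ _ _ pt (fun x => 'd f x (delta_mx j 0)) xy
      (cpt xy) (cf _ _)).
  have cS : compact (`[0, 1]%classic `*` `[0, 1]%classic : set (R * R)).
    by apply: compact_setX; exact: segment_compact.
  have S0 : (`[0, 1]%classic `*` `[0, 1]%classic : set (R * R)) !=set0.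
    by exists (0, 0); split; rewrite /= in_itv /= lexx ler01.
  have [c _ hc] := compact_EVT_max S0 cS (continuous_subspaceT cg).
  exists (g c) => [|x hx]; first exact: normr_ge0.
  have -> : x = pt (x 0 0, x 1 0).
    apply/matrixP => i k; rewrite (ord1 k) mxE /=.
    by case: i => [[|[|//]] hi] /=; congr (x _ _); apply/val_inj.
  by apply: (hc (x 0 0, x 1 0)); rewrite inE; split; rewrite /= in_itv /=; exact: hx.
have [c0 c00 h0] := bound 0; have [c1 c10 h1] := bound 1.
exists (2 * (c0 + c1)) => [|u v hu hv]; first by rewrite mulr_ge0// addr_ge0.
apply: mx_norm_le => [|i j]; first by rewrite !mulr_ge0// addr_ge0.
rewrite (ord1 j); have [s /andP[s0 s1] ->] := mvt_coord u v i df.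
apply: le_trans (le_mx_norm _ _ _) _; apply: diff_norm_le => k.
have hx l : 0 <= (v + s *: (u - v)) l 0 <= 1.
  rewrite !mxE; have /andP[? ?] := hu l; have /andP[? ?] := hv l.
  by apply/andP; split; nra.
case: k => [[|[|//]] hk].
  have -> : Ordinal hk = 0 by apply/val_inj.
  by apply: le_trans (h0 _ hx) _; rewrite lerDl.
have -> : Ordinal hk = 1 by apply/val_inj.
by apply: le_trans (h1 _ hx) _; rewrite lerDr.
Qed.

End CoordinateEstimates.

Section Counting.
Context {R : realType}.

Lemma injective_lower_bound m n (L : 'M[R]_(m, n)) :
  (forall w : 'cV[R]_n, L *m w = 0 -> w = 0) ->
  exists2 k, 0 < k & forall w : 'cV[R]_n, k * `|w| <= `|L *m w|.
Proof.
move=> hL.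
have /row_freeP[K hK] : row_free L^T.
  apply: inj_row_free => v hv; apply: trmx_inj; rewrite trmx0; apply: hL.
  by apply: trmx_inj; rewrite trmx_mul trmxK trmx0.
have hK' : K^T *m L = 1%:M by rewrite -[L]trmxK -trmx_mul hK trmx1.
set c := m%:R * `|K^T| + 1.
have c0 : 0 < c by rewrite ltr_wpDl// mulr_ge0.
exists c^-1 => [|w]; first by rewrite invr_gt0.
rewrite mulrC ler_pdivrMr// -{1}[w]mul1mx -hK' -mulmxA.
apply: le_trans (mx_normM _ _) _.
by rewrite [leRHS]mulrC ler_wpM2r// lerDl.
Qed.

(** The unit square splits into [(K * n) ^ 2] boxes of side [1 / (K * n)], fewer
    than the [n ^ 3] points, so that two of them share a box. *)
Lemma grid_pigeonhole K n (X : 'I_n * ('I_n * 'I_n) -> 'cV[R]_2) :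
  (0 < K)%N -> (K ^ 2 < n)%N ->
  (forall p i, 0 <= X p i 0 < 1) ->
  exists p q, p != q /\ `|X p - X q| <= ((K * n)%:R)^-1.
Proof.
move=> K0 Kn hX.
have Kn0 : (0 < K * n)%N by rewrite muln_gt0 K0 (leq_trans _ Kn).
have KnR : 0 < (K * n)%:R :> R by rewrite ltr0n.
have hb p i : (Num.truncn (X p i 0 * (K * n)%:R)%R < K * n)%N.
  have /andP[h0 h1] := hX p i.
  by rewrite truncn_lt_nat ?mulr_ge0// gtr_pMl.
pose box p : 'I_(K * n) * 'I_(K * n) := (Ordinal (hb p 0), Ordinal (hb p 1)).
have [/injectiveP inj|/injectivePn[p [q pq e]]] := boolP (injectiveb box).
  have := leq_card box inj; rewrite !card_prod !card_ord => h; exfalso.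
  have n0 : (0 < n)%N by apply: leq_trans Kn.
  move: h; rewrite mulnACA leq_pmul2r ?muln_gt0 ?n0//.
  by rewrite mulnn leqNgt Kn.
exists p, q; split => //.
have [e0 e1] := (congr1 (fun b => val b.1) e, congr1 (fun b => val b.2) e).
apply: mx_norm_le => [|i j]; first by rewrite invr_ge0 ltW.
rewrite (ord1 j) !mxE.
have ei : Num.truncn (X p i 0 * (K * n)%:R) = Num.truncn (X q i 0 * (K * n)%:R).
  by case: i => [[|[|//]] hi]; [move: e0|move: e1] => /=;
    (have -> : Ordinal hi = 0 by exact/val_inj) ||
    (have -> : Ordinal hi = 1 by exact/val_inj).
have /andP[p0 _] := hX p i; have /andP[q0 _] := hX q i.
have /andP[p1 p2] := truncn_itv (mulr_ge0 p0 (ltW KnR)).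
have /andP[q1 q2] := truncn_itv (mulr_ge0 q0 (ltW KnR)).
rewrite ei in p1 p2.
rewrite -[leRHS]mul1r ler_pdivlMr// -(gtr0_norm KnR) -normrM mulrBl.
rewrite -natr1 in p2 q2.
by rewrite ler_norml; apply/andP; split; lra.
Qed.

End Counting.

(** * An invariant surface is tangent to the orbits *)

Section Jacobian.
Context {R : realType} {m : nat}.

Definition jac (f : 'cV[R]_2 -> 'cV[R]_m) u : 'M[R]_(m, 2) :=
  \matrix_(i, j) ('d f u (delta_mx j 0)) i 0.

Lemma jacE f u w : jac f u *m w = 'd f u w.
Proof.
rewrite (diff_plane f u w); apply/matrixP => i j.
rewrite (ord1 j) mxE !big_ord_recl big_ord0 !mxE.
have -> : lift 0 0 = 1 :> 'I_2 by apply/val_inj.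
by rewrite addr0 mulrC [X in _ + X = _]mulrC.
Qed.

End Jacobian.

Section Transversality.
Context {R : realType} {n : nat}.

(** If the surface were transverse to the orbits at [u0], the map
    [(t, u) |-> expm (t *: B) *m f u] would expand distances, up to a factor, on a
    small cube around [(0, u0)], while all its values have preimages under [f] in
    the unit square, where [f] is Lipschitz.  A fine grid of the cube would then
    yield too many separated points in the square. *)
Lemma invariant_not_transverse (f : 'cV[R]_2 -> 'cV[R]_n.+1) (B : 'M[R]_n.+1) u0 :
  Ck 1 f ->
  (forall t u, exists2 v : 'cV[R]_2, forall i, 0 <= v i 0 < 1 &
     f v = expm (t *: B) *m f u) ->
  ~ (forall s (w : 'cV[R]_2), s *: (B *m f u0) + 'd f u0 w = 0 -> s = 0 /\ w = 0).
Proof.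
move=> cf inv transv.
pose E (t : R) := expm (t *: B).
(* The linearisation at [(0, u0)] expands distances by the factor [k]. *)
have [k k0 hk] : exists2 k : R, 0 < k & forall s (w : 'cV[R]_2),
    k * `|s| <= `|s *: (B *m f u0) + 'd f u0 w| /\
    k * `|w| <= `|s *: (B *m f u0) + 'd f u0 w|.
  pose L : 'M[R]_(n.+1, 1 + 2) := row_mx (B *m f u0) (jac f u0).
  have LE s (w : 'cV[R]_2) :
      L *m col_mx s%:M w = s *: (B *m f u0) + 'd f u0 w.
    by rewrite mul_row_col mul_mx_scalar jacE.
  have [v|k k0 hk] := @injective_lower_bound R _ _ L.
    rewrite -[v]vsubmxK [usubmx v]mx11_scalar LE => /transv[-> ->].
    by rewrite raddf0 col_mx0.
  exists k => // s w; have := hk (col_mx s%:M w); rewrite LE => hsw.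
  split; apply: le_trans hsw; rewrite ler_wpM2l ?(ltW k0)//.
    have := le_mx_norm (col_mx s%:M w) (lshift 2 0) 0.
    by rewrite col_mxEu mxE eqxx mulr1n.
  apply: mx_norm_le => // i j.
  by have := le_mx_norm (col_mx s%:M w) (rshift 1 i) j; rewrite col_mxEd.
have [C C0 hC] := expm_lipschitz B.
have [d d0 hd] := C1_strict u0 cf (divr_gt0 k0 (ltr0n R 4)).
have [D D0 hD] : exists2 D, 0 <= D & forall w, `|'d f u0 w| <= D * `|w|.
  exists (2%:R * `|jac f u0|) => [|w]; first exact: mulr_ge0.
  by rewrite -jacE mx_normM.
pose l := k / 4 + D.
have l0 : 0 <= l by rewrite addr_ge0// divr_ge0// ltW.
pose N : R := n.+1%:R.
have N0 : 0 <= N by [].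
pose b := `|B|.
pose Q := N * C * (`|f u0| + l) + N * b * l + N * (C + b) * l + 1.
have b0 : 0 <= b by exact: normr_ge0.
have Q0 : 0 < Q.
  rewrite ltr_wpDl//.
  by repeat (assumption || exact: normr_ge0 || apply: addr_ge0 || apply: mulr_ge0).
pose h := Num.min (Num.min d 1) (k / (8 * Q)).
have h0 : 0 < h by rewrite !lt_min d0 ltr01 divr_gt0// mulr_gt0.
have hd' : h <= d by rewrite !ge_min lexx.
have h1 : h <= 1 by rewrite !ge_min lexx orbT.
have hQ : Q * h <= k / 8.
  have : h <= k / (8 * Q) by rewrite !ge_min lexx orbT.
  by rewrite ler_pdivlMr ?mulr_gt0//; lra.
have h01 : 0 <= h <= 1 by rewrite ltW.
have fl u v : `|u - u0| <= h -> `|v - u0| <= h -> `|f u - f v| <= l * `|u - v|.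
  move=> hu hv; rewrite -[f u - f v](subrK ('d f u0 (u - v))).
  apply: le_trans (ler_normD _ _) _; rewrite mulrDl lerD//.
  by apply: hd; [exact: le_trans hd'|exact: le_trans hd'].
(* On a cube of side [h] the error terms below amount to at most half of the
   linear part, so the nonlinear map expands distances by [k / 2]. *)
have sep t s u v : `|t| <= h -> `|s| <= h -> `|u - u0| <= h -> `|v - u0| <= h ->
    k / 2 * Num.max `|t - s| `|u - v| <= `|E t *m f u - E s *m f v|.
  move=> ht hs hu hv.
  set M := Num.max _ _.
  have tM : `|t - s| <= M by rewrite le_max lexx.
  have uM : `|u - v| <= M by rewrite le_max lexx orbT.
  have M0 : 0 <= M by apply: le_trans tM.
  set Lin := (t - s) *: (B *m f u0) + 'd f u0 (u - v).
  have kM : k * M <= `|Lin|.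
    have [ha hb] := hk (t - s) (u - v).
    by rewrite /M /Lin maxEle; case: ifP.
  set T1 := (E t - E s - (t - s) *: B) *m f u.
  set T2 := (t - s) *: (B *m (f u - f u0)).
  set T3 := (E s - 1) *m (f u - f v).
  set T4 := f u - f v - 'd f u0 (u - v).
  have -> : E t *m f u - E s *m f v = Lin + (T1 + T2 + T3 + T4).
    rewrite /Lin /T1 /T2 /T3 /T4 !mulmxBl !mulmxBr -scalemxAl !mul1mx scalerBr.
    by apply/matrixP => i j; rewrite !mxE; ring.
  have fu : `|f u - f u0| <= l * h.
    apply: le_trans (fl u u0 hu _) _; first by rewrite subrr normr0 ltW.
    by rewrite ler_wpM2l.
  have fu' : `|f u| <= `|f u0| + l.
    rewrite -[f u](subrK (f u0)) addrC; apply: le_trans (ler_normD _ _) _.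
    by rewrite lerD2l; apply: le_trans fu _; rewrite ler_piMr.
  have Es : `|E s - 1| <= (C + b) * h.
    have := hC s 0 h h01 hs; rewrite normr0 subr0 scale0r expm0 => /(_ (ltW h0)) hE.
    rewrite -[E s - 1](subrK (s *: B)); apply: le_trans (ler_normD _ _) _.
    rewrite mulrDl normrZ; apply: lerD; last by rewrite mulrC ler_wpM2l.
    apply: le_trans hE _; rewrite -[leRHS]mulr1 ler_wpM2l ?mulr_ge0// ?(ltW h0)//.
    exact: le_trans h1.
  have hT1 : `|T1| <= N * C * (`|f u0| + l) * h * M.
    apply: le_trans (mx_normM _ _) _; rewrite -/N.
    have hE := hC t s h h01 ht hs.
    apply: (@le_trans _ _ (N * (C * h * M) * (`|f u0| + l))).
      apply: ler_pM => //; first by rewrite mulr_ge0.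
      rewrite ler_wpM2l//; apply: le_trans hE _.
      by rewrite ler_wpM2l// mulr_ge0// ltW.
    by rewrite le_eqVlt; apply/orP; left; apply/eqP; ring.
  have hT2 : `|T2| <= N * b * l * h * M.
    rewrite /T2 normrZ; apply: (@le_trans _ _ (M * (N * b * (l * h)))).
      apply: ler_pM => //; apply: le_trans (mx_normM _ _) _.
      by rewrite ler_wpM2l// mulr_ge0.
    by rewrite le_eqVlt; apply/orP; left; apply/eqP; ring.
  have hT3 : `|T3| <= N * (C + b) * l * h * M.
    apply: le_trans (mx_normM _ _) _; rewrite -/N.
    apply: (@le_trans _ _ (N * ((C + b) * h) * (l * M))).
      apply: ler_pM => //; first by rewrite mulr_ge0.
        by rewrite ler_wpM2l.
      by apply: le_trans (fl u v hu hv) _; rewrite ler_wpM2l.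
    by rewrite le_eqVlt; apply/orP; left; apply/eqP; ring.
  have hT4 : `|T4| <= k / 4 * M.
    apply: le_trans (hd _ _ _ _) _; [exact: le_trans hd'|exact: le_trans hd'|].
    by rewrite ler_wpM2l// divr_ge0// ltW.
  have hT : `|T1 + T2 + T3 + T4| <= k / 2 * M.
    have QM : Q * h * M <= k / 8 * M by rewrite ler_wpM2r.
    have hM : 0 <= h * M by rewrite mulr_ge0// ltW.
    have kM0 : 0 <= k * M by rewrite mulr_ge0// ltW.
    apply: le_trans (ler_normD _ _) _.
    apply: (@le_trans _ _ (Q * h * M + k / 4 * M)); last by lra.
    apply: lerD => //; apply: le_trans (ler_normD _ _) _.
    apply: (@le_trans _ _ (`|T1| + `|T2| + `|T3|)); first by rewrite lerD2r ler_normD.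
    by rewrite /Q !mulrDl mul1r; lra.
  have := lerB_normD Lin (T1 + T2 + T3 + T4).
  by move=> hB; apply: le_trans hB; lra.
have [Lf Lf0 hLf] := C1_lipschitz_square cf.
have [K K0 hK] : exists2 K : nat, (0 < K)%N & 2 * Lf < k * h * K%:R.
  have kh : 0 < k * h by rewrite mulr_gt0.
  exists (Num.truncn (2 * Lf / (k * h))).+1 => //.
  by rewrite [ltRHS]mulrC -ltr_pdivrMr// truncnS_gt.
(* The grid has step [h / g]; [K] is such that two preimages in a common box
   have images closer than the expansion of one step of the grid permits. *)
set g := (K ^ 2).+1.
pose gr (i : 'I_g) : R := h * (i%:R / g%:R).
have g0 : 0 < g%:R :> R by [].
have gr0 i : 0 <= gr i by rewrite mulr_ge0 ?divr_ge0// ltW.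
have grh i : gr i <= h.
  by rewrite ger_pMr// ler_pdivrMr// mul1r ler_nat ltnW.
pose T (p : 'I_g * ('I_g * 'I_g)) := gr p.1.
pose U (p : 'I_g * ('I_g * 'I_g)) : 'cV[R]_2 :=
  u0 + \col_i gr (if i == 0 then p.2.1 else p.2.2).
pose X p := projT1 (cid2 (inv (T p) (U p))).
have hX p : (forall i, 0 <= X p i 0 < 1) /\ f (X p) = E (T p) *m f (U p).
  by rewrite /X; case: cid2.
have [p [q [pq pq_le]]] := grid_pigeonhole K0 (leqnn g) (fun p => (hX p).1).
have normU r : `|U r - u0| <= h.
  rewrite /U addrC addKr; apply: mx_norm_le => [|i j]; first exact: ltW.
  by rewrite mxE ger0_norm.
have normT r : `|T r| <= h by rewrite /T ger0_norm.
have := sep _ _ _ _ (normT p) (normT q) (normU p) (normU q).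
rewrite -(hX p).2 -(hX q).2.
have le01 (x : R) : 0 <= x < 1 -> 0 <= x <= 1 by move=> /andP[-> /ltW].
have := hLf _ _ (fun i => le01 _ ((hX p).1 i)) (fun i => le01 _ ((hX q).1 i)).
have grB (i j : 'I_g) : i != j -> h / g%:R <= `|gr i - gr j|.
  move=> ij; rewrite /gr -mulrBr -mulrBl !normrM (gtr0_norm h0).
  rewrite ler_wpM2l ?(ltW h0)// (@ger0_norm _ (g%:R^-1)) ?invr_ge0 ?(ltW g0)//.
  rewrite -[leLHS]mul1r ler_wpM2r ?invr_ge0 ?(ltW g0)//.
  wlog lt_ij : i j ij / (j < i)%N.
    move=> hw; have := ij; rewrite -val_eqE neq_ltn => /orP[|/hw]; last exact.
    by move=> /hw; rewrite eq_sym distrC; apply.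
  by rewrite -natrB ?(ltnW lt_ij)// ger0_norm// ler1n subn_gt0.
have big : h / g%:R <= Num.max `|T p - T q| `|U p - U q|.
  have [e1|n1] := eqVneq p.1 q.1; last by rewrite le_max grB.
  have [i hi] : exists i : 'I_2, h / g%:R <= `|(U p - U q) i 0|.
    have dU i : (U p - U q) i 0 = gr (if i == 0 then p.2.1 else p.2.2) -
                                  gr (if i == 0 then q.2.1 else q.2.2).
      by rewrite !mxE; ring.
    have [e2|n2] := eqVneq p.2.1 q.2.1; last by exists 0; rewrite dU grB.
    exists 1; rewrite dU grB//; apply: contra pq => /eqP e3.
    by rewrite -pair_eqE /pair_eq /= e1 eqxx -pair_eqE /pair_eq /= e2 e3 !eqxx.
  by rewrite le_max; apply/orP; right; apply: le_trans hi _; exact: le_mx_norm.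
move: pq_le big; set x := `|X p - X q|; set M := Num.max _ _.
rewrite natrM invfM => x_le M_ge up low.
have KR : 0 < K%:R :> R by rewrite ltr0n.
have hup : `|f (X p) - f (X q)| <= Lf / K%:R / g%:R.
  by apply: le_trans up _; rewrite -mulrA ler_wpM2l.
have hlow : k / 2 * (h / g%:R) <= `|f (X p) - f (X q)|.
  by apply: le_trans low; rewrite ler_wpM2l// divr_ge0// ltW.
have := le_trans hlow hup; rewrite mulrA ler_pM2r ?invr_gt0//.
rewrite ler_pdivlMr//; lra.
Qed.

End Transversality.

(** * Orthonormal frames of R^4 and the Hodge star *)

Section OrthonormalFrames.
Context {R : realType}.
Implicit Types (x y u w : 'cV[R]_4) (B : 'M[R]_4).

Let i0 := @Ordinal 4 0 isT.
Let i1 := @Ordinal 4 1 isT.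
Let i2 := @Ordinal 4 2 isT.
Let i3 := @Ordinal 4 3 isT.

Let sum4 (F : 'I_4 -> R) : \sum_i F i = F i0 + F i1 + F i2 + F i3.
Proof.
rewrite !big_ord_recl big_ord0 addr0 !addrA.
by congr (F _ + F _ + F _ + F _); apply/val_inj.
Qed.

Definition orthoframe x y u w : Prop :=
  [/\ dotp x x = 1, dotp y y = 1, dotp u u = 1 & dotp w w = 1] /\
  [/\ dotp x y = 0, dotp x u = 0 & dotp x w = 0] /\
  [/\ dotp y u = 0, dotp y w = 0 & dotp u w = 0].

Lemma orthoframe_swap x y u w : orthoframe x y u w -> orthoframe u w x y.
Proof.
move=> [[? ? ? ?] [[? ? ?] [? ? ?]]].
by split; [|split]; split=> //; rewrite dotpC.
Qed.

Lemma parseval x y u w z z' : orthoframe x y u w ->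
  dotp z z' = dotp z x * dotp z' x + dotp z y * dotp z' y +
              dotp z u * dotp z' u + dotp z w * dotp z' w.
Proof.
move=> [[xx yy uu ww] [[xy xu xw] [yu yw uw]]].
pose F : 'M[R]_4 := \matrix_(i, j) (nth 0 [:: x; y; u; w] j) i 0.
have FE (v : 'cV[R]_4) j : (F^T *m v) j 0 = dotp v (nth 0 [:: x; y; u; w] j).
  by rewrite dotpC /dotp !mxE; apply: eq_bigr => i _; rewrite !mxE.
have FF : F^T *m F = 1%:M.
  apply/matrixP => i j.
  have -> : (F^T *m F) i j = dotp (nth 0 [:: x; y; u; w] i) (nth 0 [:: x; y; u; w] j).
    by rewrite /dotp !mxE; apply: eq_bigr => k _; rewrite !mxE.
  by rewrite mxE; case: i j => [[|[|[|[|//]]]] hi] [[|[|[|[|//]]]] hj] /=;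
    rewrite -?val_eqE /= // dotpC.
have -> : dotp z z' = dotp (F^T *m z) (F^T *m z').
  by rewrite /dotp trmx_mul trmxK -mulmxA (mulmxA F) (mulmx1C FF) mul1mx.
by rewrite dotpE sum4 !FE.
Qed.

Definition wedge x y : 'M[R]_4 := y *m x^T - x *m y^T.

Let wedgeE x y i j : wedge x y i j = y i 0 * x j 0 - x i 0 * y j 0.
Proof. by rewrite !mxE !big_ord1 !mxE. Qed.

(** The Hodge star of [so 4]: [star B] is obtained from [B] by exchanging
    complementary coordinate planes. *)
Definition star B : 'M[R]_4 := \matrix_(i, j)
  nth 0 (nth [::] [:: [:: 0; B i2 i3; - B i1 i3; B i1 i2];
                      [:: - B i2 i3; 0; B i0 i3; - B i0 i2];
                      [:: B i1 i3; - B i0 i3; 0; B i0 i1];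
                      [:: - B i1 i2; B i0 i2; - B i0 i1; 0]] i) j.

Lemma star_so B : so (star B).
Proof.
apply/matrixP => i j; rewrite !mxE.
by case: i j => [[|[|[|[|//]]]] hi] [[|[|[|[|//]]]] hj] /=; rewrite ?opprK ?oppr0.
Qed.

Let so_entry B i j : so B -> B i j = - B j i.
Proof. by move=> /matrixP/(_ j i); rewrite !mxE. Qed.

Let so_diag B i : so B -> B i i = 0.
Proof. by move=> hB; have := so_entry i i hB; lra. Qed.

Lemma star_starK B : so B -> star (star B) = B.
Proof.
move=> hB; apply/matrixP => i j; rewrite !mxE.
have h k l : k = i -> l = j -> B k l = B i j by move=> -> ->.
have hN k l : k = j -> l = i -> - B k l = B i j.
  by move=> -> ->; rewrite (so_entry i j hB).
have h0 : i = j -> 0 = B i j by move=> ->; rewrite so_diag.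
by case: i j h hN h0 => [[|[|[|[|//]]]] hi] [[|[|[|[|//]]]] hj] h hN h0 /=;
  rewrite ?mxE /= ?opprK; (exact/h0/val_inj || (apply: h; exact/val_inj) ||
    (apply: hN; exact/val_inj)).
Qed.

Lemma star_pairing B x y : dotp (star B *m x) y =
  B i2 i3 * (x i1 0 * y i0 0 - x i0 0 * y i1 0) -
  B i1 i3 * (x i2 0 * y i0 0 - x i0 0 * y i2 0) +
  B i1 i2 * (x i3 0 * y i0 0 - x i0 0 * y i3 0) +
  B i0 i3 * (x i2 0 * y i1 0 - x i1 0 * y i2 0) -
  B i0 i2 * (x i3 0 * y i1 0 - x i1 0 * y i3 0) +
  B i0 i1 * (x i3 0 * y i2 0 - x i2 0 * y i3 0).
Proof. by rewrite dotpE !sum4 !mxE !sum4 !mxE /=; ring. Qed.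

(** The determinant of the four vectors. *)
Definition orient x y u w := dotp (star (wedge u w) *m x) y.

Let so_frame B x y u w k l : so B -> orthoframe x y u w ->
  B k l = \sum_(p <- [:: (x, y); (x, u); (x, w); (y, u); (y, w); (u, w)])
            dotp (B *m p.1) p.2 * (p.2 k 0 * p.1 l 0 - p.1 k 0 * p.2 l 0).
Proof.
move=> hB o.
have hd (v : 'cV[R]_4) i : dotp (delta_mx i 0) v = v i 0.
  rewrite dotpE (bigD1 i) //= big1 ?mxE ?eqxx ?mul1r ?addr0// => j ji.
  by rewrite mxE (negbTE ji) mul0r.
have -> : B k l = dotp (B *m delta_mx l 0) (delta_mx k 0).
  by rewrite dotpC hd -colE mxE.
rewrite (parseval _ _ o) !hd !(dotp_so (delta_mx l 0) _ hB).
rewrite !(parseval (delta_mx l 0) (B *m _) o) !hd !(dotp_so_diag _ hB).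
rewrite !big_cons big_nil /=.
rewrite (dotpC (B *m y) x) (dotpC (B *m u) x) (dotpC (B *m u) y)
        (dotpC (B *m w) x) (dotpC (B *m w) y) (dotpC (B *m w) u).
have sk (a b : 'cV[R]_4) : dotp a (B *m b) = - dotp (B *m a) b.
  by rewrite (dotp_so a b hB) opprK.
by rewrite !sk; ring.
Qed.

(** Expanding [B] on the planes of the frame, only its component on the plane
    [u], [w] contributes: the star of any plane meeting the span of [x] and [y]
    vanishes on the pair [x], [y]. *)
Lemma star_frame B x y u w : so B -> orthoframe x y u w ->
  dotp (star B *m x) y = orient x y u w * dotp (B *m u) w.
Proof.
move=> hB o; rewrite /orient !star_pairing.
by rewrite !(so_frame _ _ hB o) !big_cons !big_nil /= !wedgeE; ring.
Qed.

Lemma wedge_so x y : so (wedge x y).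
Proof. by rewrite /so /= /wedge linearB /= !trmx_mul !trmxK opprB. Qed.

(** Applying [star_frame] to the plane [u], [w], then to its star and the frame
    with the two planes exchanged, multiplies by the orientation twice. *)
Lemma orient_sqr x y u w : orthoframe x y u w -> orient x y u w ^+ 2 = 1.
Proof.
move=> o; have o' := orthoframe_swap o; have [[xx yy uu ww] [_ [_ _ uw]]] := o.
have h1 : dotp (wedge u w *m u) w = 1.
  rewrite /wedge mulmxBl -!mulmxA [u^T *m u]mx11_scalar [w^T *m u]mx11_scalar.
  rewrite -/(dotp u u) -/(dotp w u) uu (dotpC w u) uw.
  by rewrite raddf0 mulmx0 subr0 mulmx1.
have e1 := star_frame (wedge_so u w) o.
have e2 := star_frame (star_so (wedge u w)) o'.
rewrite star_starK ?h1 in e2; last exact: wedge_so.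
have e3 : orient u w x y = orient x y u w.
  by rewrite /orient !star_pairing !wedgeE; ring.
by rewrite e3 e1 h1 mulr1 in e2; rewrite expr2.
Qed.

Lemma orient_continuous (T : topologicalType) (x y u w : T -> 'cV[R]_4) :
  continuous x -> continuous y -> continuous u -> continuous w ->
  continuous (fun t => orient (x t) (y t) (u t) (w t)).
Proof.
move=> cx cy cu cw; apply: dotp_continuous => //; apply: mulmx_continuous => //.
have cT (v : T -> 'cV[R]_4) : continuous v -> continuous (fun t => (v t)^T).
  move=> cv; apply: mx_continuous => i j; under eq_fun do rewrite mxE.
  exact: coord_continuousT.
have cW : continuous (fun t => wedge (u t) (w t)).
  move=> t; apply: cvgB.
    exact: (mulmx_continuous cw (cT _ cu)).
  exact: (mulmx_continuous cu (cT _ cw)).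
have cWij i j : continuous (fun t => wedge (u t) (w t) i j).
  exact: coord_continuousT.
have cWN i j : continuous (fun t => - wedge (u t) (w t) i j).
  by move=> t; apply: cvgN; exact: cWij.
apply: mx_continuous => i j; under eq_fun do rewrite mxE.
by case: i j => [[|[|[|[|//]]]] hi] [[|[|[|[|//]]]] hj] /=;
  (exact: cst_continuous || exact: cWij || exact: cWN).
Qed.

End OrthonormalFrames.

(** * Surfaces of the 3-sphere *)

Lemma orthoframe_ext (R : realType) (x y u w z z' : 'cV[R]_4) :
  orthoframe x y u w ->
  dotp z x = dotp z' x -> dotp z y = dotp z' y ->
  dotp z u = dotp z' u -> dotp z w = dotp z' w -> z = z'.
Proof.
move=> o hx hy hu hw; apply/eqP; rewrite -subr_eq0; apply/eqP; apply: dotp_eq0.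
have h v : dotp z v = dotp z' v -> dotp (z - z') v = 0.
  by rewrite dotpDl -scaleN1r dotpZl => ->; ring.
by rewrite (parseval _ _ o) !h// !mulr0 !addr0.
Qed.

Record surface (R : realType) (r n : 'cV[R]_2 -> 'cV[R]_4) : Prop := Surface {
  surface_C2 : Ck 2 r;
  surface_normal_C1 : Ck 1 n;
  surface_immersion : forall u v, 'd r u v = 0 -> v = 0;
  surface_sphere : forall u, dotp (r u) (r u) = 1;
  surface_normal_unit : forall u, dotp (n u) (n u) = 1;
  surface_normal_orth : forall u, dotp (n u) (r u) = 0;
  surface_normal : forall u v, dotp (n u) ('d r u v) = 0 }.

Section SurfaceGeometry.
Context {R : realType} {r n : 'cV[R]_2 -> 'cV[R]_4} (S : surface r n).
Implicit Types (u v w : 'cV[R]_2).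

Let rd u : differentiable r u.
Proof. by have [] := surface_C2 S. Qed.

Let nd u : differentiable n u.
Proof. by have [] := surface_normal_C1 S. Qed.

Let drd v u : differentiable (fun x => 'd r x v) u.
Proof. by have [_ /(_ v)[]] := surface_C2 S. Qed.

Lemma diff_eq_cst (g : 'cV[R]_2 -> R) c u v : (forall x, g x = c) -> 'd g u v = 0.
Proof.
move=> gc; have -> : g = cst c by apply/funext.
by rewrite diff_cst.
Qed.

Lemma dotp_diff u v : dotp ('d r u v) (r u) = 0.
Proof.
have := diff_eq_cst u v (surface_sphere S).
by rewrite (diff_dotp v (rd u) (rd u)).2 (dotpC (r u)); lra.
Qed.

Lemma dotp_diff_normal u v : dotp ('d n u v) (n u) = 0.
Proof.
have := diff_eq_cst u v (surface_normal_unit S).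
by rewrite (diff_dotp v (nd u) (nd u)).2 (dotpC (n u)); lra.
Qed.

Lemma dotp_diff_normal_pos u v : dotp ('d n u v) (r u) = 0.
Proof.
have := diff_eq_cst u v (surface_normal_orth S).
by rewrite (diff_dotp v (nd u) (rd u)).2 (surface_normal S) addr0.
Qed.

(** Differentiating the orthogonality of [n] and ['d r] expresses both sides by
    second derivatives of [r]. *)
Lemma second_form_sym u v w :
  dotp ('d n u v) ('d r u w) = dotp ('d n u w) ('d r u v).
Proof.
have h a b : dotp ('d n u a) ('d r u b) = - dotp (n u) ('d (fun x => 'd r x b) u a).
  have := diff_eq_cst u a (fun x => surface_normal S x b).
  by rewrite (diff_dotp a (nd u) (drd b u)).2; lra.
apply: (etrans (h v w)); apply: (etrans _ (esym (h w v))).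
by congr (- dotp _ _); exact: (schwarz_mx u w v (surface_C2 S)).
Qed.

Definition frame_at u v w := orthoframe (r u) (n u) ('d r u v) ('d r u w).

Lemma frame_at_intro u v w : dotp ('d r u v) ('d r u v) = 1 ->
  dotp ('d r u w) ('d r u w) = 1 -> dotp ('d r u v) ('d r u w) = 0 ->
  frame_at u v w.
Proof.
move=> hv hw hvw.
have hr := surface_sphere S u; have hn := surface_normal_unit S u.
have hnr := surface_normal_orth S u.
split; [by split|split; split=> //].
- by rewrite dotpC.
- by rewrite dotpC dotp_diff.
- by rewrite dotpC dotp_diff.
- exact: surface_normal.
- exact: surface_normal.
Qed.

(** By the Gram-Schmidt process, starting from [v] rotated in the parameters. *)
Lemma frame_at_exists u v : dotp ('d r u v) ('d r u v) = 1 ->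
  exists w, frame_at u v w.
Proof.
move=> hv.
have lin a b c d : 'd r u (c *: a + d *: b) = c *: 'd r u a + d *: 'd r u b.
  by rewrite linearD !linearZ.
pose v' : 'cV[R]_2 := \col_i (if i == 0 then - v 1 0 else v 0 0).
set c := dotp ('d r u v') ('d r u v).
pose w := 1 *: v' + (- c) *: v.
have wv : dotp ('d r u w) ('d r u v) = 0.
  by rewrite /w lin dotpDl !dotpZl hv -/c; ring.
have w_neq0 : w != 0.
  apply/eqP => /matrixP h; have := h 0 0; have := h 1 0.
  rewrite !mxE /= => h1 h0.
  have v0 : v 0 0 ^+ 2 + v 1 0 ^+ 2 = 0 by nra.
  move: v0 => /eqP; rewrite paddr_eq0 ?sqr_ge0// !sqrf_eq0 => /andP[/eqP v0 /eqP v1].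
  have ve : v = 0.
    apply/matrixP => i j; rewrite (ord1 j) mxE.
    by case: i => [[|[|//]] hi]; [rewrite -[RHS]v0|rewrite -[RHS]v1];
      congr (v _ _); apply/val_inj.
  by move: hv; rewrite ve linear0 dotp0l => /eqP; rewrite eq_sym oner_eq0.
have ww : 0 < dotp ('d r u w) ('d r u w).
  rewrite lt_def dotp_ge0 andbT; apply: contra w_neq0 => /eqP h.
  by apply/eqP; apply: (surface_immersion S (u := u)); exact: dotp_eq0.
set s := dotp ('d r u w) ('d r u w) in ww.
have s0 : Num.sqrt s != 0 by rewrite sqrtr_eq0 -ltNge.
exists ((Num.sqrt s)^-1 *: w).
have dE : 'd r u ((Num.sqrt s)^-1 *: w) = (Num.sqrt s)^-1 *: 'd r u w.
  by rewrite linearZ.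
apply: frame_at_intro => //; rewrite dE.
  rewrite dotpZl dotpZr -/s -[X in _ * (_ * X)](sqr_sqrtr (ltW ww)).
  by field.
by rewrite dotpZr dotpC wv mulr0.
Qed.

Lemma frame_at_basis u v w x : frame_at u v w ->
  x = dotp ('d r u x) ('d r u v) *: v + dotp ('d r u x) ('d r u w) *: w.
Proof.
move=> o; have [[_ _ vv ww] [_ [_ _ vw]]] := o.
have wv : dotp ('d r u w) ('d r u v) = 0 by rewrite dotpC.
set c := dotp _ _; set d := dotp _ ('d r u w).
apply/eqP; rewrite -subr_eq0; apply/eqP; apply: (surface_immersion S (u := u)).
have e : 'd r u (x - (c *: v + d *: w)) = 'd r u x - (c *: 'd r u v + d *: 'd r u w).
  by rewrite linearB linearD !linearZ.
rewrite e; apply/eqP; rewrite subr_eq0; apply/eqP; apply: (orthoframe_ext o).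
- by rewrite dotpDl !dotpZl !dotp_diff !mulr0 addr0.
- by rewrite dotpDl !dotpZl !(dotpC _ (n u)) !(surface_normal S) !mulr0 addr0.
- by rewrite dotpDl !dotpZl vv wv mulr0 addr0 mulr1.
- by rewrite dotpDl !dotpZl vw ww mulr0 add0r mulr1.
Qed.

End SurfaceGeometry.

Arguments frame_at {R} r n u v w.

(** * Principal frames and the Hopf differential along a Killing field *)

(** In the basis [v], [w] the Gram matrix becomes the identity, hence its inverse
    is [V *m V^T] for the matrix [V] with columns [v] and [w]. *)
Lemma mxtrace_frame (R : realType) m (J K : 'M[R]_(m, 2)) (v w : 'cV[R]_2) :
  dotp (J *m v) (J *m v) = 1 -> dotp (J *m w) (J *m w) = 1 ->
  dotp (J *m v) (J *m w) = 0 ->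
  \tr (invmx (J^T *m J) *m (K^T *m J)) =
    dotp (K *m v) (J *m v) + dotp (K *m w) (J *m w).
Proof.
move=> vv ww vw.
pose V : 'M[R]_2 := \matrix_(i, j) (if j == 0 then v else w) i 0.
have VE (A : 'M[R]_(m, 2)) i j : (A *m V) i j = (A *m (if j == 0 then v else w)) i 0.
  by rewrite !mxE; apply: eq_bigr => k _; rewrite mxE.
have VV (A A' : 'M[R]_(m, 2)) i j : (V^T *m (A^T *m A') *m V) i j =
    dotp (A *m (if i == 0 then v else w)) (A' *m (if j == 0 then v else w)).
  rewrite mulmxA -trmx_mul -mulmxA /dotp !mxE; apply: eq_bigr => k _.
  by rewrite [X in X * _]mxE [in RHS]mxE !VE.
have VJ : V^T *m (J^T *m J) *m V = 1%:M.
  apply/matrixP => i j; rewrite VV mxE.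
  by case: i j => [[|[|//]] hi] [[|[|//]] hj] //=; rewrite -?val_eqE //= dotpC.
have GV : (J^T *m J) *m (V *m V^T) = 1%:M.
  by rewrite mulmxA; apply: mulmx1C; rewrite mulmxA.
have Gu : J^T *m J \in unitmx by case/mulmx1_unit: GV.
have -> : invmx (J^T *m J) = V *m V^T.
  by rewrite -[RHS]mul1mx -(mulVmx Gu) -mulmxA GV mulmx1.
rewrite -mulmxA mxtrace_mulC /mxtrace !big_ord_recl big_ord0 addr0 !VV /=.
by rewrite -?val_eqE.
Qed.

Section PrincipalFrame.
Context {R : realType} {x y e1 e2 : 'cV[R]_4} (o : orthoframe x y e1 e2) {a : R}.

Lemma principal_complement (f1 f2 : 'cV[R]_4) : f1 = - a *: e1 ->
  dotp f2 x = 0 -> dotp f2 y = 0 -> dotp f2 e1 = dotp f1 e2 ->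
  dotp f1 e1 + dotp f2 e2 = 0 -> f2 = a *: e2.
Proof.
move=> -> fx fy sym tr; have [[_ _ ee1 ee2] [[_ xe1 xe2] [ye1 ye2 e12]]] := o.
rewrite !dotpZl in sym tr; rewrite ee1 in tr; rewrite e12 in sym.
apply: (orthoframe_ext o).
- by rewrite fx dotpZl dotpC xe2 mulr0.
- by rewrite fy dotpZl dotpC ye2 mulr0.
- by rewrite sym dotpZl dotpC e12 !mulr0.
- by rewrite dotpZl ee2; lra.
Qed.

Context {B : 'M[R]_4} (B_so : so B) (B_tangent : dotp (B *m x) y = 0).
Hypothesis diff1 : dotp (B *m e1) y + dotp (B *m x) (- a *: e1) = 0.
Hypothesis diff2 : dotp (B *m e2) y + dotp (B *m x) (a *: e2) = 0.
Let p := dotp (B *m x) e1.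
Let q := dotp (B *m x) e2.
Let b := dotp (B *m e2) e1.

Let By1 : dotp (B *m y) e1 = - a * p.
Proof.
by move: diff1; rewrite dotpZr (dotp_so _ y B_so) (dotpC e1) -/p => h; lra.
Qed.

Let By2 : dotp (B *m y) e2 = a * q.
Proof.
by move: diff2; rewrite dotpZr (dotp_so _ y B_so) (dotpC e2) -/q => h; lra.
Qed.

Let Byx : dotp (B *m y) x = 0.
Proof. by rewrite (dotp_so _ _ B_so) dotpC B_tangent oppr0. Qed.

Let B12 : dotp (B *m e1) e2 = - b.
Proof. by rewrite (dotp_so _ _ B_so) dotpC. Qed.

(** In this frame [B *m y] is the image of the Killing field [B *m x] under the
    differential of the normal, which multiplies [e1] by [- a] and [e2] by [a]. *)
Lemma killing_norms :
  [/\ dotp (B *m x) (B *m x) = p ^+ 2 + q ^+ 2,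
      dotp (B *m y) (B *m y) = a ^+ 2 * (p ^+ 2 + q ^+ 2) &
      dotp (B *m x) (B *m y) = a * (q ^+ 2 - p ^+ 2)].
Proof.
split; rewrite (parseval _ _ o).
- by rewrite (dotp_so_diag x B_so) B_tangent -/p -/q; ring.
- by rewrite Byx (dotp_so_diag y B_so) By1 By2; ring.
- rewrite (dotp_so_diag x B_so) (dotp_so_diag y B_so) B_tangent By1 By2 -/p -/q.
  by ring.
Qed.

Lemma killing_rotation :
  [/\ dotp (B *m e1) (B *m x) = - b * q,
      dotp (B *m e2) (B *m x) = b * p,
      dotp (B *m e1) (B *m y) = - b * (a * q) &
      dotp (B *m e2) (B *m y) = - b * (a * p)].
Proof.
split; rewrite (parseval _ _ o).
- by rewrite (dotp_so_diag x B_so) B_tangent (dotp_so_diag e1 B_so) B12 -/q; ring.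
- by rewrite (dotp_so_diag x B_so) B_tangent (dotp_so_diag e2 B_so) -/b -/p; ring.
- by rewrite Byx (dotp_so_diag y B_so) (dotp_so_diag e1 B_so) B12 By2; ring.
- by rewrite Byx (dotp_so_diag y B_so) (dotp_so_diag e2 B_so) -/b By1; ring.
Qed.

(** [v] is a tangent vector and [f] its image under the differential of the normal;
    the two sums are the derivatives along [v] of [<B x, B y>] and, up to the order
    of the factors, of [|B x|^2 |B y|^2]. *)
Lemma killing_variation (c d : R) (v f : 'cV[R]_4) :
  v = c *: e1 + d *: e2 -> f = c *: (- a *: e1) + d *: (a *: e2) ->
  dotp (B *m v) (B *m y) + dotp (B *m x) (B *m f) = 0 /\
  dotp (B *m x) (B *m x) * (2 * dotp (B *m f) (B *m y)) +
    dotp (B *m y) (B *m y) * (2 * dotp (B *m v) (B *m x)) = 0.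
Proof.
move=> -> ->; have [r1 r2 r3 r4] := killing_rotation.
have [k1 k2 _] := killing_norms.
have r1' := etrans (dotpC _ _) r1; have r2' := etrans (dotpC _ _) r2.
rewrite !mulmxDr -!scalemxAr !(dotpDl, dotpDr) !(dotpZl, dotpZr).
by rewrite r1 r1' r2 r2' r3 r4 k1 k2; split; ring.
Qed.

End PrincipalFrame.

Section MinimalGeometry.
Context {R : realType} {r n : 'cV[R]_2 -> 'cV[R]_4} (S : surface r n).
Context {a : 'cV[R]_2 -> R} {w1 : 'cV[R]_2 -> 'cV[R]_2}.
Hypothesis mean0 : forall u v w, frame_at r n u v w ->
  dotp ('d n u v) ('d r u v) + dotp ('d n u w) ('d r u w) = 0.
Hypothesis w1_unit : forall u, dotp ('d r u (w1 u)) ('d r u (w1 u)) = 1.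
Hypothesis w1_principal : forall u, 'd n u (w1 u) = - a u *: 'd r u (w1 u).

Lemma diff_complement u w : frame_at r n u (w1 u) w -> 'd n u w = a u *: 'd r u w.
Proof.
move=> o; apply: (principal_complement o (w1_principal u)).
- exact: dotp_diff_normal_pos S u w.
- exact: dotp_diff_normal S u w.
- exact: second_form_sym S u w (w1 u).
- exact: mean0 o.
Qed.

(** From here on [B] generates isometries preserving the surface, that is, the
    Killing field [x |-> B *m x] is tangent to it. *)
Context {B : 'M[R]_4} (B_so : so B).
Hypothesis B_tangent : forall u, dotp (B *m r u) (n u) = 0.

Let rd u : differentiable r u.
Proof. by have [] := surface_C2 S. Qed.

Let nd u : differentiable n u.
Proof. by have [] := surface_normal_C1 S. Qed.

Lemma diff_tangent u v :
  dotp (B *m 'd r u v) (n u) + dotp (B *m r u) ('d n u v) = 0.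
Proof.
have h := diff_eq_cst u v B_tangent.
have [dB eB] := diff_mulmx B v (rd u).
apply: (etrans _ h); apply: esym; apply: (etrans (diff_dotp v dB (nd u)).2).
by congr (dotp _ _ + _).
Qed.

Lemma diff_tangent_frame u w : frame_at r n u (w1 u) w ->
  dotp (B *m 'd r u (w1 u)) (n u) + dotp (B *m r u) (- a u *: 'd r u (w1 u)) = 0 /\
  dotp (B *m 'd r u w) (n u) + dotp (B *m r u) (a u *: 'd r u w) = 0.
Proof.
move=> o; rewrite -(w1_principal u) -(diff_complement o).
by split; exact: diff_tangent.
Qed.

Lemma diff_killing u v :
  [/\ 'd (fun x => dotp (B *m r x) (B *m r x)) u v =
        2 * dotp (B *m 'd r u v) (B *m r u),
      'd (fun x => dotp (B *m n x) (B *m n x)) u v =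
        2 * dotp (B *m 'd n u v) (B *m n u) &
      'd (fun x => dotp (B *m r x) (B *m n x)) u v =
        dotp (B *m 'd r u v) (B *m n u) + dotp (B *m r u) (B *m 'd n u v)].
Proof.
have [dBr eBr] := diff_mulmx B v (rd u); have [dBn eBn] := diff_mulmx B v (nd u).
have sqr (z z' c : 'cV[R]_4) : z = z' -> dotp z c + dotp c z = 2 * dotp z' c.
  by move=> ->; rewrite (dotpC c); ring.
split.
- exact: (etrans (diff_dotp v dBr dBr).2 (sqr _ _ (B *m r u) eBr)).
- exact: (etrans (diff_dotp v dBn dBn).2 (sqr _ _ (B *m n u) eBn)).
- apply: (etrans (diff_dotp v dBr dBn).2).
  exact: (congr2 (fun z z' => dotp z (B *m n u) + dotp (B *m r u) z') eBr eBn).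
Qed.

Lemma killing_differentiable u :
  [/\ differentiable (fun x => dotp (B *m r x) (B *m r x)) u,
      differentiable (fun x => dotp (B *m n x) (B *m n x)) u &
      differentiable (fun x => dotp (B *m r x) (B *m n x)) u].
Proof.
have [dBr _] := diff_mulmx B 0 (rd u); have [dBn _] := diff_mulmx B 0 (nd u).
by split; [exact: (diff_dotp 0 dBr dBr).1|exact: (diff_dotp 0 dBn dBn).1|
           exact: (diff_dotp 0 dBr dBn).1].
Qed.

Lemma diff_decomposition u w v : frame_at r n u (w1 u) w ->
  exists c d, 'd r u v = c *: 'd r u (w1 u) + d *: 'd r u w /\
              'd n u v = c *: (- a u *: 'd r u (w1 u)) + d *: (a u *: 'd r u w).
Proof.
move=> o; have e := frame_at_basis S v o.
have lin (g : 'cV[R]_2 -> 'cV[R]_4) c d z z' : 'd g u (c *: z + d *: z') =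
    c *: 'd g u z + d *: 'd g u z' by rewrite linearD !linearZ.
exists (dotp ('d r u v) ('d r u (w1 u))), (dotp ('d r u v) ('d r u w)).
split; first exact: (etrans (congr1 _ e) (lin r _ _ _ _)).
rewrite -(w1_principal u) -(diff_complement o).
exact: (etrans (congr1 _ e) (lin n _ _ _ _)).
Qed.

(** This function and the one of the next lemma are, up to sign, the real part and
    the squared modulus of the Hopf differential evaluated twice on the Killing
    field. *)
Lemma hopf_real_cst u u' :
  dotp (B *m r u) (B *m n u) = dotp (B *m r u') (B *m n u').
Proof.
apply: (@diff0_cst _ _ (fun x => dotp (B *m r x) (B *m n x))) => [x|x v].
  by have [] := killing_differentiable x.
have [w o] := frame_at_exists S (w1_unit x).
have [_ _ e] := diff_killing x v; apply: (etrans e).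
have [c [d [er en]]] := diff_decomposition v o.
have [t1 t2] := diff_tangent_frame o.
exact: (killing_variation o B_so (B_tangent x) t1 t2 er en).1.
Qed.

Lemma hopf_norm_cst u u' :
  dotp (B *m r u) (B *m r u) * dotp (B *m n u) (B *m n u) =
  dotp (B *m r u') (B *m r u') * dotp (B *m n u') (B *m n u').
Proof.
apply: (@diff0_cst _ _ (fun x => dotp (B *m r x) (B *m r x) *
                                dotp (B *m n x) (B *m n x))) => [x|x v].
  by have [d1 d2 _] := killing_differentiable x; exact: differentiableM.
have [d1 d2 _] := killing_differentiable x.
have [w o] := frame_at_exists S (w1_unit x).
have [e1 e2 _] := diff_killing x v.
have e : 'd (fun x => dotp (B *m r x) (B *m r x) * dotp (B *m n x) (B *m n x)) x v =
   dotp (B *m r x) (B *m r x) * (2 * dotp (B *m 'd n x v) (B *m n x)) +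
   dotp (B *m n x) (B *m n x) * (2 * dotp (B *m 'd r x v) (B *m r x)).
  by rewrite -e1 -e2; exact: (congr1 (fun h => h v) (diffM d1 d2)).
have [c [d [er en]]] := diff_decomposition v o.
have [t1 t2] := diff_tangent_frame o.
exact: (etrans e (killing_variation o B_so (B_tangent x) t1 t2 er en).2).
Qed.

End MinimalGeometry.

(** * The principal curvature of an invariant minimal surface *)

Section InvariantMinimalSurface.
Context {R : realType} {r n : 'cV[R]_2 -> 'cV[R]_4} (S : surface r n).
Context {a : 'cV[R]_2 -> R} {w1 w2 : 'cV[R]_2 -> 'cV[R]_2}.
Hypothesis a_ge0 : forall u, 0 <= a u.
Hypothesis mean0 : forall u v w, frame_at r n u v w ->
  dotp ('d n u v) ('d r u v) + dotp ('d n u w) ('d r u w) = 0.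
Hypothesis w1_continuous : continuous w1.
Hypothesis w2_continuous : continuous w2.
Hypothesis w1_unit : forall u, dotp ('d r u (w1 u)) ('d r u (w1 u)) = 1.
Hypothesis w2_unit : forall u, dotp ('d r u (w2 u)) ('d r u (w2 u)) = 1.
Hypothesis w1_principal : forall u, 'd n u (w1 u) = - a u *: 'd r u (w1 u).
Hypothesis w2_principal : forall u, 'd n u (w2 u) = a u *: 'd r u (w2 u).
Context {B : 'M[R]_4} (B_so : so B).
Hypothesis B_tangent : forall u, dotp (B *m r u) (n u) = 0.

Let killing2 u := dotp (B *m r u) (B *m r u).
Let normal2 u := dotp (B *m n u) (B *m n u).

Let rC1 : Ck 1 r.
Proof.
have [dr ddr] := surface_C2 S; split=> // v x.
exact: differentiable_continuous ((ddr v).1 x).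
Qed.

Let r_continuous : continuous r.
Proof. by move=> u; apply: differentiable_continuous; exact: rC1.1. Qed.

Let n_continuous : continuous n.
Proof.
by move=> u; apply: differentiable_continuous; exact: (surface_normal_C1 S).1.
Qed.

Lemma curvature_continuous : continuous a.
Proof.
have -> : a = (fun u => - dotp ('d n u (w1 u)) ('d r u (w1 u))).
  apply/funext => u; apply: esym.
  apply: (etrans (congr1 (fun z => - dotp z _) (w1_principal u))).
  by rewrite dotpZl w1_unit mulr1 opprK.
have c1 := continuous_diff (surface_normal_C1 S) w1_continuous.
have c2 := continuous_diff rC1 w1_continuous.
have c12 := dotp_continuous c1 c2; move=> u; exact: (cvgN (c12 u)).
Qed.

Lemma hopf_norm u : (a u * killing2 u) ^+ 2 = killing2 u * normal2 u.
Proof.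
have [w o] := frame_at_exists S (w1_unit u).
have [t1 t2] := diff_tangent_frame S mean0 w1_principal B_tangent o.
have [k1 k2 _] := killing_norms o B_so (B_tangent u) t1 t2.
by rewrite /killing2 /normal2 k1 k2; ring.
Qed.

(** If the Hopf differential vanishes on the Killing field somewhere, it does
    everywhere.  A non-umbilic point would then have a neighbourhood on which the
    Killing field vanishes, and a linear Killing field vanishing on a piece of
    surface is zero. *)
Lemma totally_geodesic u0 u : B != 0 -> killing2 u0 * normal2 u0 = 0 -> a u = 0.
Proof.
move=> B0 G0; apply/eqP; apply: contraT => au.
have Br0 x : a x != 0 -> B *m r x = 0.
  move=> ax; apply: dotp_eq0; apply/eqP.
  have /eqP := hopf_norm x.
  have -> : killing2 x * normal2 x = 0.
    rewrite -G0.
    exact: (hopf_norm_cst S mean0 w1_unit w1_principal B_so B_tangent).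
  by rewrite sqrf_eq0 mulf_eq0 (negbTE ax).
have nearB : \forall x \near u, B *m r x = 0.
  exact: (filterS Br0 (cvgr_neq0 _ (@curvature_continuous u) au)).
have dr0 v : B *m 'd r u v = 0.
  have [dB <-] := diff_mulmx B v (rC1.1 u).
  rewrite -(deriveE _ dB) (near_eq_derive (g := cst 0))//.
  by rewrite derive_cst.
have [w o] := frame_at_exists S (w1_unit u).
have Bn : B *m n u = 0.
  apply: (orthoframe_ext o).
  - by rewrite (dotp_so _ _ B_so) (Br0 u au) dotpC !dotp0l oppr0.
  - by rewrite dotp_so_diag// dotp0l.
  - by rewrite (dotp_so _ _ B_so) dr0 dotpC !dotp0l oppr0.
  - by rewrite (dotp_so _ _ B_so) dr0 dotpC !dotp0l oppr0.
have Bz (z : 'cV[R]_4) : B *m z = 0.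
  apply: (orthoframe_ext o).
  - by rewrite (dotp_so _ _ B_so) (Br0 u au) dotpC !dotp0l oppr0.
  - by rewrite (dotp_so _ _ B_so) Bn dotpC !dotp0l oppr0.
  - by rewrite (dotp_so _ _ B_so) dr0 dotpC !dotp0l oppr0.
  - by rewrite (dotp_so _ _ B_so) dr0 dotpC !dotp0l oppr0.
exfalso; apply/(negP B0)/eqP/matrixP => i j.
have := congr1 (fun z : 'cV[R]_4 => z i 0) (Bz (delta_mx j 0)).
by rewrite -colE !mxE.
Qed.

Lemma principal_frame u : a u != 0 -> frame_at r n u (w1 u) (w2 u).
Proof.
move=> au; apply: (frame_at_intro S (w1_unit u) (w2_unit u)).
have h (e1 e2 f1 f2 : 'cV[R]_4) : f1 = - a u *: e1 -> f2 = a u *: e2 ->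
    dotp f1 e2 = dotp f2 e1 -> dotp e1 e2 = 0.
  move=> -> ->; rewrite !dotpZl (dotpC e2) => h.
  by apply: (mulfI au); lra.
exact: h (w1_principal u) (w2_principal u) (second_form_sym S u (w1 u) (w2 u)).
Qed.

Let p u := dotp (B *m r u) ('d r u (w1 u)).
Let q u := dotp (B *m r u) ('d r u (w2 u)).
Let b u := dotp (B *m 'd r u (w2 u)) ('d r u (w1 u)).
Let delta u := orient (r u) (n u) ('d r u (w1 u)) ('d r u (w2 u)).

Section NonUmbilic.
Context {c : R} (c_gt0 : 0 < c).
Hypothesis hopf_c : forall u, a u * killing2 u = c.

Lemma curvature_gt0 u : 0 < a u.
Proof.
rewrite lt_def a_ge0 andbT; apply/eqP => a0.
by have := c_gt0; rewrite -(hopf_c u) a0 mul0r ltxx.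
Qed.

Let frame u : frame_at r n u (w1 u) (w2 u).
Proof. by apply: principal_frame; rewrite gt_eqF ?curvature_gt0. Qed.

(** As [a] times the squared length of the Killing field is constant, the
    logarithmic derivative of [a] measures how [B] rotates the tangent plane. *)
Lemma curvature_diff u :
  'd a u (w1 u) = 2 / c * a u ^+ 2 * b u * q u /\
  'd a u (w2 u) = - (2 / c * a u ^+ 2 * b u * p u).
Proof.
have [dK _ _] := killing_differentiable S (B := B) u.
have k0 x : killing2 x != 0.
  by apply/eqP => k0; have := c_gt0; rewrite -(hopf_c x) k0 mulr0 ltxx.
have aE : a = (fun x => c * (killing2 x)^-1).
  by apply/funext => x; rewrite -(hopf_c x) mulfK.
have da : differentiable a u.
  by rewrite aE; apply: differentiableM => //; apply: differentiableV.
have d_a v : 'd a u v = - (2 / c * a u ^+ 2 * dotp (B *m 'd r u v) (B *m r u)).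
  have [eK _ _] := diff_killing S (B := B) u v.
  have h0 := diff_eq_cst u v hopf_c.
  have hM : 'd (fun x => a x * killing2 x) u v =
      a u * 'd killing2 u v + killing2 u * 'd a u v.
    exact: (congr1 (fun h => h v) (diffM da dK)).
  have := etrans (esym hM) h0; rewrite [X in _ * X + _]eK => h.
  have kE : killing2 u = c / a u.
    by rewrite -(hopf_c u) mulrC mulKf// gt_eqF ?curvature_gt0.
  have a0 : a u != 0 by rewrite gt_eqF ?curvature_gt0.
  have c0 : c != 0 by rewrite gt_eqF.
  apply: (mulfI (k0 u)); move: h; rewrite kE.
  set D := dotp _ _; set X := 'd a u v => h.
  have -> : c / a u * X = - (a u * (2 * D)).
    by apply/eqP; rewrite -addr_eq0 addrC; apply/eqP.
  by field; rewrite a0 c0.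
have [t1 t2] := diff_tangent_frame S mean0 w1_principal B_tangent (frame u).
have [r1 r2 _ _] := killing_rotation (frame u) B_so (B_tangent u) t1 t2.
split; [apply: (etrans (d_a (w1 u)))|apply: (etrans (d_a (w2 u)))].
  by rewrite r1 -/(b u) -/(q u); ring.
by rewrite r2 -/(b u) -/(p u); ring.
Qed.

Let sqrt_a u := Num.sqrt (a u).

Let sqrt_a_sqr u : sqrt_a u ^+ 2 = a u.
Proof. by rewrite sqr_sqrtr// ltW ?curvature_gt0. Qed.

Let sqrt_a_continuous : continuous sqrt_a.
Proof.
move=> u.
exact: (continuous_comp (@curvature_continuous u) (@sqrt_continuous R _)).
Qed.

Let diff1_continuous : continuous (fun u => 'd r u (w1 u)).
Proof. exact: continuous_diff. Qed.

Let diff2_continuous : continuous (fun u => 'd r u (w2 u)).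
Proof. exact: continuous_diff. Qed.

Let Br_continuous : continuous (fun u => B *m r u).
Proof. by apply: mulmx_continuous => //; exact: cst_continuous. Qed.

(** In the conformal metric [a] times the induced one, the Killing field has
    constant components along the principal directions: their squares are
    determined by the Hopf differential. *)
Lemma killing_components_cst u u' :
  sqrt_a u * p u = sqrt_a u' * p u' /\ sqrt_a u * q u = sqrt_a u' * q u'.
Proof.
have sq x : (sqrt_a x * p x) ^+ 2 = (c - dotp (B *m r x) (B *m n x)) / 2 /\
            (sqrt_a x * q x) ^+ 2 = (c + dotp (B *m r x) (B *m n x)) / 2.
  have [t1 t2] := diff_tangent_frame S mean0 w1_principal B_tangent (frame x).
  have [k1 _ k3] := killing_norms (frame x) B_so (B_tangent x) t1 t2.
  rewrite -/(p x) -/(q x) in k1 k3.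
  rewrite -(hopf_c x) /killing2 k1 k3 !exprMn sqrt_a_sqr.
  by split; field.
have cP := hopf_real_cst S mean0 w1_unit w1_principal B_so B_tangent.
split.
  have cp : continuous (fun x => sqrt_a x * p x).
    have cp := dotp_continuous Br_continuous diff1_continuous.
    by move=> x; exact: (cvgM (@sqrt_a_continuous x) (cp x)).
  apply: (sqr_cst_cst cp) => x x'.
  by rewrite (sq x).1 (sq x').1 (cP x x').
have cq : continuous (fun x => sqrt_a x * q x).
  have cq := dotp_continuous Br_continuous diff2_continuous.
  by move=> x; exact: (cvgM (@sqrt_a_continuous x) (cq x)).
apply: (sqr_cst_cst cq) => x x'.
by rewrite (sq x).2 (sq x').2 (cP x x').
Qed.

Lemma orient_cst u u' : delta u = delta u'.
Proof.
apply: sqr_cst_cst => [|x x'].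
  exact: orient_continuous r_continuous n_continuous diff1_continuous
    diff2_continuous.
exact: (etrans (orient_sqr (frame x)) (esym (orient_sqr (frame x')))).
Qed.

(** By [star_frame], as the orientation squares to one. *)
Lemma rotation_star u : b u = - delta u * dotp (star B *m r u) (n u).
Proof.
have e := star_frame B_so (frame u).
have e' : dotp (B *m 'd r u (w1 u)) ('d r u (w2 u)) = - b u.
  by rewrite (dotp_so _ _ B_so) dotpC.
rewrite e e' -/(delta u).
have := orient_sqr (frame u); rewrite -/(delta u) => d2.
by transitivity (delta u ^+ 2 * b u); [rewrite d2 mul1r|ring].
Qed.

Lemma curvature_derivative_killing s t : exists2 C, so C & forall u,
  s * (a u `^ (- (3 / 2))) * 'd a u (w1 u) +
  t * (a u `^ (- (3 / 2))) * 'd a u (w2 u) = dotp (C *m r u) (n u).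
Proof.
pose k := - delta 0 * (2 / c) * (s * (sqrt_a 0 * q 0) - t * (sqrt_a 0 * p 0)).
exists (k *: star B) => [|u].
  by have /= hs := star_so B; rewrite /so /= linearZ /= hs scalerN.
rewrite -scalemxAl dotpZl.
have [-> ->] := curvature_diff u.
have powE : a u `^ (- (3 / 2)) * a u ^+ 2 = sqrt_a u.
  rewrite -powR_mulrn// -powRD; last by rewrite (gt_eqF (curvature_gt0 u)) implybT.
  by rewrite /sqrt_a -powR12_sqrt//; congr (_ `^ _); field.
have [ep eq] := killing_components_cst 0 u.
rewrite /k ep eq (orient_cst 0 u) rotation_star -powE.
move: (a u `^ _) => A; have c0 : c != 0 by rewrite gt_eqF.
by field.
Qed.

End NonUmbilic.

Lemma natural_is_killing s t : B != 0 -> exists2 C, so C & forall u,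
  s * (a u `^ (- (3 / 2))) * 'd a u (w1 u) +
  t * (a u `^ (- (3 / 2))) * 'd a u (w2 u) = dotp (C *m r u) (n u).
Proof.
move=> B0.
have [G0|G0] := eqVneq (killing2 0 * normal2 0) 0.
  exists 0 => [|u]; first by rewrite /so /= trmx0 oppr0.
  rewrite (totally_geodesic u B0 G0).
  rewrite powR0 ?oppr_eq0 ?mulf_neq0 ?invr_eq0 ?pnatr_eq0//.
  by rewrite !mulr0 !mul0r addr0 mul0mx dotp0l.
have K0 u : 0 <= a u * killing2 u by rewrite mulr_ge0// dotp_ge0.
have cst u : a u * killing2 u = a 0 * killing2 0.
  apply/eqP; rewrite -(eqrXn2 (n := 2))// !hopf_norm; apply/eqP.
  exact: (hopf_norm_cst S mean0 w1_unit w1_principal B_so B_tangent).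
apply: (curvature_derivative_killing (c := a 0 * killing2 0)) => //.
rewrite lt_def K0 andbT -sqrf_eq0 hopf_norm; exact: G0.
Qed.

End InvariantMinimalSurface.

(** * Killing-Jacobi functions on the torus *)

Section Torus.
Context {R : realType} (M : torus R).

Lemma lift_param (m : M) : param M (Defs.lift m) = m.
Proof. exact: projT2 (cid (param_surj m)). Qed.

Lemma unit_cell (m : M) :
  exists2 v : 'cV[R]_2, forall i, 0 <= v i 0 < 1 & param M v = m.
Proof.
have [u <-] := param_surj m.
exists (u - \col_i (Num.floor (u i 0))%:~R) => [i|].
  rewrite !mxE; have := floor_le_tmp (u i 0); have := floorD1_gt (u i 0).
  by rewrite intrD1 => h1 h2; apply/andP; split; lra.
by apply/param_eq => i; rewrite !mxE opprB addrCA subrr addr0 intr_int.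
Qed.

(** Two parameters of the same point differ by a period of [f \o param M]. *)
Lemma tdiff_param (W : normedModType R) (f : M -> W) u v :
  (forall x, differentiable (fun y => f (param M y)) x) ->
  tdiff f (param M u) v = 'd (fun y => f (param M y)) u v.
Proof.
move=> df; rewrite /tdiff.
set l := Defs.lift _.
have := (@param_eq R M (Defs.lift (param M u)) u).1 (lift_param _); rewrite -/l => ul.
have per : (fun y => f (param M (y + (u - l)))) = (fun y => f (param M y)).
  apply/funext => y; congr (f _); apply/param_eq => i.
  rewrite !mxE.
  have -> : y i 0 - (y i 0 + (u i 0 - l i 0)) = - (u i 0 - l i 0) by ring.
  by rewrite rpredN.
have := (diff_shift v (df (l + (u - l)))).2.
by rewrite per subrKC.
Qed.

End Torus.

Section SkewDimension.
Context {R : realType}.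

Let i0 := @Ordinal 4 0 isT.
Let i1 := @Ordinal 4 1 isT.
Let i2 := @Ordinal 4 2 isT.
Let i3 := @Ordinal 4 3 isT.

Let upper : seq ('I_4 * 'I_4) :=
  [:: (i0, i1); (i0, i2); (i0, i3); (i1, i2); (i1, i3); (i2, i3)].

Let so_eq0 (C : 'M[R]_4) : so C ->
  (forall k : 'I_6, C (nth (i0, i0) upper k).1 (nth (i0, i0) upper k).2 = 0) -> C = 0.
Proof.
move=> /matrixP hC hk.
have sk i j : C i j = - C j i by have := hC j i; rewrite !mxE.
have h k (hk6 : (k < 6)%N) := hk (Ordinal hk6).
have c01 := h 0 isT; have c02 := h 1 isT; have c03 := h 2 isT.
have c12 := h 3 isT; have c13 := h 4 isT; have c23 := h 5 isT.
have up (i j : 'I_4) : (i < j)%N -> C i j = 0.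
  have ci k l : k = i -> l = j -> C k l = 0 -> C i j = 0 by move=> -> ->.
  case: i j ci => [[|[|[|[|//]]]] hi] [[|[|[|[|//]]]] hj] ci // _;
    [apply: ci c01|apply: ci c02|apply: ci c03|apply: ci c12|apply: ci c13|
     apply: ci c23]; exact/val_inj.
apply/matrixP => i j; rewrite mxE; case: (ltngtP i j) => [/up//|/up h'|/val_inj->].
  by rewrite sk h' oppr0.
by have := sk j j; lra.
Qed.

(** The six entries above the diagonal determine a skew-symmetric matrix. *)
Lemma so_dependent m (C : 'I_m -> 'M[R]_4) : (6 < m)%N -> (forall i, so (C i)) ->
  exists c : 'I_m -> R, (exists i, c i != 0) /\ \sum_i c i *: C i = 0.
Proof.
move=> m6 hC.
pose A : 'M[R]_(m, 6) :=
  \matrix_(i, k) C i (nth (i0, i0) upper k).1 (nth (i0, i0) upper k).2.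
have ker0 : kermx A != 0.
  rewrite -mxrank_eq0 mxrank_ker subn_eq0 -ltnNge.
  by apply: leq_ltn_trans m6; exact: rank_leq_col.
have /rowV0Pn[v /sub_kermxP vA v0] := ker0.
exists (v 0); split.
  have /rV0Pn[i vi] := v0; by exists i.
apply: so_eq0 => [|k].
  rewrite /so /= linear_sum /= -sumrN; apply: eq_bigr => i _.
  by have := hC i; rewrite /so /= linearZ /= => ->; rewrite scalerN.
rewrite summxE; have := congr1 (fun z : 'rV[R]_6 => z 0 k) vA.
rewrite !mxE => h; rewrite -[RHS]h.
by apply: eq_bigr => i _; rewrite !mxE.
Qed.

End SkewDimension.

Section KillingNullity.
Context {R : realType} {M : torus R} {rho N : M -> 'cV[R]_4}.

Lemma f_D (B C : 'M[R]_4) l m :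
  f_ rho N (B + l *: C) m = f_ rho N B m + l * f_ rho N C m.
Proof. by rewrite /f_ mulmxDl -scalemxAl dotpDl dotpZl. Qed.

Lemma f_sum n (c : 'I_n -> R) (C : 'I_n -> 'M[R]_4) m :
  f_ rho N (\sum_i c i *: C i) m = \sum_i c i * f_ rho N (C i) m.
Proof.
rewrite /f_ mulmx_suml /dotp linear_sum /= mulmx_suml summxE.
by apply: eq_bigr => i _; rewrite -scalemxAl -/(dotp _ _) dotpZl.
Qed.

(** Matrices whose Killing-Jacobi functions are independent stay independent when
    [B] is added to them, and there are at most six independent ones in [so 4]. *)
Lemma killing_nullity_le5 (B : 'M[R]_4) : so B -> B != 0 ->
  (forall m, f_ rho N B m = 0) -> (killing_nullity rho N <= 5%:E)%E.
Proof.
move=> hB B0 fB; apply: ge_ereal_sup => _ [n [F [FK Find]] <-].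
rewrite lee_fin ler_nat leqNgt; apply/negP => n6.
have [C hC] : exists C : 'I_n -> 'M[R]_4, forall i, so (C i) /\ f_ rho N (C i) = F i.
  exists (fun i => projT1 (cid2 (FK i))) => i.
  by case: cid2.
pose C' (i : 'I_n.+1) := oapp C B (unlift ord0 i).
have [|c [[i ci] cC]] := @so_dependent R n.+1 C' n6.
  by move=> i; rewrite /C'; case: unlift => [j|] //=; exact: (hC j).1.
have c0 j : c (lift ord0 j) = 0.
  apply: (Find (fun j => c (lift ord0 j))) => m.
  have := f_sum c C' m; rewrite cC big_ord_recl /C' unlift_none /= fB mulr0 add0r.
  rewrite [f_ _ _ 0 _]/f_ mul0mx dotp0l => h; rewrite [RHS]h.
  by apply: eq_bigr => k _; rewrite liftK /= (hC k).2.
move: cC; rewrite big_ord_recl big1 ?addr0 => [|j _]; last by rewrite c0 scale0r.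
rewrite /C' unlift_none /= => /eqP; rewrite scaler_eq0 (negbTE B0) orbF => /eqP c00.
by move: ci; case: (unliftP ord0 i) => [j|] ->; rewrite ?c0 ?c00 eqxx.
Qed.

End KillingNullity.

Section InvariantTorus.
Context {R : realType} {M : torus R} {rho N : M -> 'cV[R]_4}.
Hypothesis rho_immersion : immersion rho.
Hypothesis N_gauss : gauss_map rho N.

Let r u := rho (param M u).
Let n u := N (param M u).

Let rC k : Ck k r.
Proof. by have [] := rho_immersion. Qed.

Let nC k : Ck k n.
Proof. by have [] := N_gauss. Qed.

Let tdiff_r u v : tdiff rho (param M u) v = 'd r u v.
Proof. exact: (tdiff_param u v (rC 1).1). Qed.

Let tdiff_n u v : tdiff N (param M u) v = 'd n u v.
Proof. exact: (tdiff_param u v (nC 1).1). Qed.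

Lemma torus_surface : surface r n.
Proof.
have [_ rr ri] := rho_immersion; have [_ nn nr nd] := N_gauss.
split.
- exact: rC.
- exact: nC.
- by move=> u v h; apply: (ri (param M u)); rewrite tdiff_r.
- by move=> u; exact: rr.
- by move=> u; exact: nn.
- by move=> u; exact: nr.
- by move=> u v; rewrite -tdiff_r; exact: nd.
Qed.

Lemma torus_mean0 u v w : minimal rho N -> frame_at r n u v w ->
  dotp ('d n u v) ('d r u v) + dotp ('d n u w) ('d r u w) = 0.
Proof.
move=> /(_ (param M u)) min [[_ _ vv ww] [_ [_ _ vw]]].
have gram (K J : 'M[R]_(4, 2)) i j :
    (K^T *m J) i j = dotp (K *m delta_mx i 0) (J *m delta_mx j 0).
  by rewrite -!colE dotpE mxE; apply: eq_bigr => k _; rewrite !mxE.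
have jr x : tdiff rho (param M u) x = jac r u *m x.
  exact: (etrans (tdiff_r u x) (esym (jacE r u x))).
have jn x : tdiff N (param M u) x = jac n u *m x.
  exact: (etrans (tdiff_n u x) (esym (jacE n u x))).
have gE : first_form rho (param M u) = (jac r u)^T *m jac r u.
  by apply/matrixP => i j; rewrite mxE gram; congr (dotp _ _); exact: jr.
have bE : second_form rho N (param M u) = - ((jac n u)^T *m jac r u).
  apply/matrixP => i j; rewrite mxE [in RHS]mxE gram.
  by congr (- dotp _ _); [exact: jn|exact: jr].
move: min; rewrite /mean_curvature gE bE mulmxN linearN /=.
have eq (g g' : 'cV[R]_2 -> 'cV[R]_4) x y :
    dotp (jac g u *m x) (jac g' u *m y) = dotp ('d g u x) ('d g' u y).
  exact: (congr2 (@Defs.dotp R 4) (jacE g u x) (jacE g' u y)).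
rewrite (mxtrace_frame (jac n u) (etrans (eq r r v v) vv) (etrans (eq r r w w) ww)
  (etrans (eq r r v w) vw)).
move=> /eqP; rewrite mulf_eq0 invr_eq0 pnatr_eq0 orbF oppr_eq0 => /eqP h.
exact: (etrans (esym (congr2 +%R (eq n r v v) (eq n r w w))) h).
Qed.

(** A normal component of [B *m rho] would make the derivative of the orbit map
    injective: the inner product with the normal isolates the time component. *)
Lemma invariant_tangent (B : 'M[R]_4) m :
  so B -> invariant_under (range rho) B -> f_ rho N B m = 0.
Proof.
move=> hB inv; have [u <-] := param_surj m.
apply/eqP; apply: contraT => fB; exfalso.
apply: (@invariant_not_transverse R 3 r B u (rC 1)) => [t x|s w h].
  have [m' _ em'] := inv t (r x) (ex_intro2 _ _ (param M x) I erefl).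
  by have [v v01 ev] := unit_cell m'; exists v => //; rewrite /r ev.
have S := torus_surface.
have s0 : s = 0.
  have := congr1 (fun z => dotp z (n u)) h.
  rewrite dotpDl dotpZl dotp0l (dotpC ('d r u w)) (surface_normal S) addr0.
  by move=> /eqP; rewrite mulf_eq0 => /orP[/eqP//|]; rewrite (negbTE fB).
split=> //; move: h; rewrite s0 scale0r add0r => h.
exact: (surface_immersion S h).
Qed.

End InvariantTorus.

Unset Implicit Arguments.

Theorem theorem5p6 (R : realType) (M : torus R)
    (rho N : M -> 'cV[R]_4) (a : M -> R) (W1 W2 : M -> 'cV[R]_2)
    (B : 'M[R]_4)
    (rho_immersion : immersion rho)
    (N_gauss : gauss_map rho N)
    (rho_minimal : minimal rho N)
    (a_ge0 : forall m, 0 <= a m)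
    (a_principal : forall m, principal_curvature rho N m (a m))
    (W1_unit : unit_field rho W1)
    (W2_unit : unit_field rho W2)
    (W1_principal : forall m, tdiff N m (W1 m) = - a m *: tdiff rho m (W1 m))
    (W2_principal : forall m, tdiff N m (W2 m) = a m *: tdiff rho m (W2 m))
    (B_so : so B) (B_neq0 : B != 0)
    (rho_invariant : invariant_under (range rho) B) :
  natural_nullity rho N a W1 W2 = killing_nullity rho N /\
  (natural_nullity rho N a W1 W2 <= 5%:E)%E.
Proof.
have fB m := invariant_tangent rho_immersion N_gauss m B_so rho_invariant.
have S := torus_surface rho_immersion N_gauss.
have rd u v : tdiff rho (param M u) v = 'd (fun x => rho (param M x)) u v.
  by apply: tdiff_param; have [/(_ 1)[]] := rho_immersion.
have nd u v : tdiff N (param M u) v = 'd (fun x => N (param M x)) u v.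
  by apply: tdiff_param; have [/(_ 1)[]] := N_gauss.
have [W1_smooth W1_1] := W1_unit; have [W2_smooth W2_1] := W2_unit.
have unit W u : dotp (tdiff rho (param M u) W) (tdiff rho (param M u) W) = 1 ->
    dotp ('d (fun x => rho (param M x)) u W) ('d (fun x => rho (param M x)) u W) = 1.
  exact: etrans (esym (congr2 (@Defs.dotp R 4) (rd u W) (rd u W))).
have principal W u k : tdiff N (param M u) W = k *: tdiff rho (param M u) W ->
    'd (fun x => N (param M x)) u W = k *: 'd (fun x => rho (param M x)) u W.
  move=> h; apply: (etrans (esym (nd u W))).
  exact: (etrans h (congr1 ( *:%R k) (rd u W))).
have h_killing theta : exists2 C, so C & forall m,
    h_ a W1 W2 theta m = f_ rho N C m.
  have [C hC hE] := @natural_is_killing R _ _ S (fun u => a (param M u))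
    (fun u => W1 (param M u)) (fun u => W2 (param M u))
    (fun u => a_ge0 _)
    (fun u v w => torus_mean0 rho_immersion N_gauss rho_minimal)
    (W1_smooth 0) (W2_smooth 0)
    (fun u => unit _ u (W1_1 _)) (fun u => unit _ u (W2_1 _))
    (fun u => principal _ u _ (W1_principal _))
    (fun u => principal _ u _ (W2_principal _))
    B B_so (fun u => fB _) (cos theta) (sin theta) B_neq0.
  exists C => // m; have := hE (Defs.lift m).
  by rewrite lift_param.
have NSE : NS rho N a W1 W2 = KS rho N.
  apply/seteqP; split => f.
    move=> [B' [l [theta [hB' ->]]]]; have [C hC hE] := h_killing theta.
    exists (B' + l *: C); last by apply/funext => m; rewrite f_D hE.
    have hB'' : B'^T = - B' := hB'; have hC' : C^T = - C := hC.
    by rewrite /so /= linearD linearZ /= hB'' hC' scalerN opprD.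
  move=> [B' hB' <-]; exists B', 0, 0; split=> //.
  by apply/funext => m; rewrite mul0r addr0.
have -> : natural_nullity rho N a W1 W2 = killing_nullity rho N.
  by rewrite /natural_nullity NSE.
by split=> //; exact: killing_nullity_le5 fB.
Qed.
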